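(* $\preccurlyeq_t^{\mathbb{F}_\infty}\restriction\Omega(\mathbb{F}_\infty)$ is a universal countable Borel quasi-order.
   Context: $\mathbb{F}_\infty$ is the free group on countably many generators. For a countable group $G$, $\preccurlyeq_t^G$ is the quasi-order on $\mathcal P(G)\cong 2^G$ given by $A\preccurlyeq_t^G B$ iff there exist $n\ge1$ and $g_1,\ldots,g_n\in G$ with $A=g_1B\cap\cdots\cap g_nB$. $\Omega(G)$ is the Borel set of infinite subsets of $G$. A countable Borel quasi-order is a Borel quasi-order on a standard Borel space with countable predecessor sets; it is universal if every countable Borel quasi-order Borel reduces to it, where $Q\leq_B Q'$ means there is a Borel $f$ with $x\mathbin{Q}y\Leftrightarrow f(x)\mathbin{Q'}f(y)$. *)

(* Defs.v *)
From HB Require Import structures.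
From mathcomp Require Import all_boot all_order all_algebra.
From mathcomp Require Import all_classical all_reals all_analysis.

Set Implicit Arguments.
Unset Strict Implicit.
Unset Printing Implicit Defensive.

Local Open Scope classical_set_scope.

(* The free group on T, realized as the group of reduced words: the letter    *)
(* (x, false) is the generator x and (x, true) is its formal inverse.         *)
Section FreeGroup.
Variable T : choiceType.
Local Notation letter := (T * bool)%type.
Implicit Types (a b : letter) (u v w : seq letter).

Definition linv a : letter := (a.1, ~~ a.2).

Definition reduced w := sorted (fun a b => b != linv a) w.

(* The reduced form of a :: w, for w reduced. *)
Definition push a w :=
  if w is b :: w' then if b == linv a then w' else a :: w else [:: a].

Definition wmul u v := foldr push v u.
Definition winv w := rev (map linv w).

Lemma linvK : involutive linv.
Proof. by case=> x b; rewrite /linv /= negbK. Qed.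

Lemma push_reduced a w : reduced w -> reduced (push a w).
Proof.
case: w => [|b w] //= rw; case: (eqVneq b (linv a)) => [_|neq].
  exact: path_sorted rw.
by rewrite /reduced /= neq.
Qed.

Lemma wmul_reduced u v : reduced v -> reduced (wmul u v).
Proof. by move=> rv; elim: u => //= a u; apply: push_reduced. Qed.

Lemma pushK a w : reduced w -> push a (push (linv a) w) = w.
Proof.
case: w => [|b w] rw /=; first by rewrite eqxx.
rewrite linvK; case: (eqVneq b a) => [eba|_] /=; last by rewrite eqxx.
subst b; case: w rw => [//|c w]; rewrite /reduced /= => /andP[cN _].
by rewrite (negbTE cN).
Qed.

Lemma wmul_push a u w : reduced w -> wmul (push a u) w = push a (wmul u w).
Proof.
case: u => [//|b u] rw /=; case: (eqVneq b (linv a)) => [->|//].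
by rewrite pushK // wmul_reduced.
Qed.

Lemma wmulA u v w : reduced w -> wmul u (wmul v w) = wmul (wmul u v) w.
Proof. by move=> rw; elim: u => //= a u ->; rewrite wmul_push. Qed.

Lemma wmulw1 u : reduced u -> wmul u [::] = u.
Proof.
elim: u => //= a u IHu ru; rewrite IHu; last exact: path_sorted ru.
by case: u ru {IHu} => //= b u; rewrite /reduced /= => /andP[/negbTE->].
Qed.

Lemma wmulVw u : wmul (winv u) u = [::].
Proof.
rewrite /wmul /winv; elim: u => //= a u IHu.
by rewrite rev_cons foldr_rcons /= linvK eqxx.
Qed.

Lemma winvK : involutive winv.
Proof. by move=> w; rewrite /winv map_rev revK mapK //; apply: linvK. Qed.

Lemma winv_reduced w : reduced w -> reduced (winv w).
Proof.
rewrite /reduced /winv rev_sorted sorted_map; apply: sub_sorted => a b /=.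
by apply: contra => /eqP ->; rewrite linvK.
Qed.

Definition freeGroup := {w : seq letter | reduced w}.

HB.instance Definition _ := Choice.on freeGroup.

Definition fg_one : freeGroup := exist reduced [::] isT.
Definition fg_mul (x y : freeGroup) : freeGroup :=
  exist reduced _ (wmul_reduced (val x) (valP y)).
Definition fg_inv (x : freeGroup) : freeGroup :=
  exist reduced _ (winv_reduced (valP x)).

Lemma fg_mulA : associative fg_mul.
Proof. by move=> x y z; apply/val_inj/wmulA/valP. Qed.
Lemma fg_mul1 : left_id fg_one fg_mul.
Proof. by move=> x; apply/val_inj. Qed.
Lemma fg_mulr1 : right_id fg_one fg_mul.
Proof. by move=> x; apply/val_inj/wmulw1/valP. Qed.
Lemma fg_mulV : left_inverse fg_one fg_inv fg_mul.
Proof. by move=> x; apply/val_inj/wmulVw. Qed.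
Lemma fg_mulrV : right_inverse fg_one fg_inv fg_mul.
Proof.
by move=> x; apply/val_inj; rewrite /= -[X in wmul X _]winvK; apply: wmulVw.
Qed.

HB.instance Definition _ :=
  isGroup.Build freeGroup fg_mulA fg_mul1 fg_mulr1 fg_mulV fg_mulrV.

Definition fg_gen (x : T) : freeGroup := exist reduced [:: (x, false)] isT.

Lemma fg_gen_inj : injective fg_gen.
Proof. by move=> x y /(congr1 val) []. Qed.

Lemma freeGroup_universal (H : groupType) (f : T -> H) :
  exists! phi : freeGroup -> H,
    {morph phi : x y / (x * y)%g} /\ forall x, phi (fg_gen x) = f x.
Proof.
pose ev a : H := if a.2 then ((f a.1)^-1)%g else f a.1.
pose evw w : H := foldr (fun a h => ev a * h)%g 1%g w.
have evV a : ev (linv a) = ((ev a)^-1)%g.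
  by case: a => x []; rewrite /ev /= ?invgK.
have ev_push a w : evw (push a w) = (ev a * evw w)%g.
  case: w => [//|b w] /=; case: (eqVneq b (linv a)) => [->|//].
  by rewrite evV mulVKg.
have evM u v : evw (wmul u v) = (evw u * evw v)%g.
  by elim: u => [|a u IHu] /=; rewrite ?mul1g // ev_push IHu mulgA.
exists (fun x => evw (val x)); split.
  by split=> [x y|x]; [exact: evM | rewrite /= mulg1].
move=> psi [psiM psi_gen]; apply/funext => -[w rw] /=.
have psi1 : psi 1%g = 1%g.
  by apply: (mulgI (psi 1%g)); rewrite -psiM !mulg1.
elim: w rw => [|a w IHw] raw; first by rewrite /= -psi1; congr psi; apply/val_inj.
have rw : reduced w by exact: path_sorted raw.
rewrite /= (IHw rw).
pose a1 : freeGroup := exist reduced [:: a] isT.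
pose w1 : freeGroup := exist reduced w rw.
have -> : exist reduced (a :: w) raw = (a1 * w1)%g.
  apply/val_inj => /=; case: w raw {rw w1 IHw} => //= b w.
  by rewrite /reduced /= => /andP[/negbTE->].
rewrite psiM; congr (_ * _)%g; rewrite /a1; case: a {raw a1} => x [] /=.
  rewrite /ev /= -psi_gen; apply: (mulgI (psi (fg_gen x))).
  rewrite mulgV -psiM -psi1; congr psi; apply/val_inj => /=.
  by rewrite /linv /= eqxx.
by rewrite /ev /= -psi_gen; congr psi; apply/val_inj.
Qed.

End FreeGroup.

Definition Finf := freeGroup nat.
HB.instance Definition _ := Group.on Finf.

(* A measurable space is standard Borel if it is isomorphic to a Polish space *)
(* (separable, completely metrizable) with its Borel sets.                    *)
Definition polish (R : realType) (M : metricType R) : Prop :=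
  (exists2 D : set M, countable D & dense D) /\
  (forall F : set_system M, ProperFilter F -> cauchy F -> exists x : M, F --> x).

Definition standard_borel (R : realType) (d : measure_display)
    (X : measurableType d) : Prop :=
  exists (M : metricType R) (f : X -> M),
    [/\ polish M, bijective f
      & forall A : set X, measurable A <-> <<s @open M >> (f @` A)].

Definition countable_borel_quasiorder (R : realType) (d : measure_display)
    (X : measurableType d) (Q : X -> X -> Prop) : Prop :=
  [/\ standard_borel R X,
      (forall x, Q x x),
      (forall x y z, Q x y -> Q y z -> Q x z),
      measurable [set p : X * X | Q p.1 p.2]
    & forall y, countable [set x | Q x y]].

Definition borel_reducible (d d' : measure_display) (X : measurableType d)
    (Y : measurableType d') (Q : X -> X -> Prop) (Q' : Y -> Y -> Prop) : Prop :=
  exists2 f : X -> Y, measurable_fun [set: X] f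
    & forall x y, Q x y <-> Q' (f x) (f y).

Definition universal_countable_borel_quasiorder (R : realType)
    (d' : measure_display) (Y : measurableType d') (Q' : Y -> Y -> Prop) : Prop :=
  countable_borel_quasiorder R Q' /\
  forall (d : measure_display) (X : measurableType d) (Q : X -> X -> Prop),
    countable_borel_quasiorder R Q -> borel_reducible Q Q'.

Definition t_le (G : groupType) (A B : set G) : Prop :=
  exists n (g : 'I_n -> G), (1 <= n)%N /\
    A = \bigcap_(i in [set: 'I_n]) [set (g i * x)%g | x in B].

(* The Borel structure of 2^G (product topology), transported to the power    *)
(* set of G along the characteristic function bijection.                      *)
Definition two_pow (G : Type) := {ptws G -> bool}.
HB.instance Definition _ (G : Type) := Pointed.on (two_pow G).
HB.instance Definition _ (G : Type) := Topological.on (two_pow G).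

Definition charfun (G : Type) (A : set G) :
  g_sigma_algebraType (@open (two_pow G)) := fun x => `[< A x >].

Definition powersetType (G : Type) := g_sigma_algebra_preimageType (@charfun G).
HB.instance Definition _ (G : Type) := Measurable.on (powersetType G).

Definition infinite_subsets (G : Type) : set (powersetType G) :=
  [set A : set G | infinite_set A].

Lemma infinite_Finf : @infinite_subsets Finf setT.
Proof.
pose h (x : Finf) := (head (0%N, false) (val x)).1.
move=> /(finite_image h) finh; apply: infinite_nat.
by apply: sub_finite_set finh => n _; exists (fg_gen n).
Qed.

(* Omega(F_infinity), with the trace of the Borel structure of the power set. *)
Definition OmegaFinf_set := set_type (@infinite_subsets Finf).
HB.instance Definition _ := Choice.on OmegaFinf_set.
HB.instance Definition _ := isPointed.Build OmegaFinf_set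
  (exist (fun A => A \in @infinite_subsets Finf) _ (mem_set infinite_Finf)).

Definition OmegaFinf := g_sigma_algebra_preimageType
  (fun A : OmegaFinf_set => set_val A : powersetType Finf).
HB.instance Definition _ := Measurable.on OmegaFinf.

Definition t_le_OmegaFinf (A B : OmegaFinf) : Prop :=
  @t_le Finf (set_val A) (set_val B).

(* Main.v *)
Require Import Defs.
From HB Require Import structures.
From mathcomp Require Import all_boot all_order all_algebra.
From mathcomp Require Import all_classical all_reals all_analysis.
From mathcomp Require Import lra zify.

(* Let Q be a countable Borel quasi-order on a standard Borel space. Recording
   which balls of a countable basis contain a point embeds the space as a Borel
   subset of the Cantor space C = nat -> bool. By the Lusin-Novikov theorem (in
   the weak form: a Borel subset of C x C with countable sections is covered by
   the graphs of countably many Borel functions) there are Borel f_n : C -> C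
   such that the Q-predecessors of v are exactly the f_n v. With generators a_n,
   b_n and d_(k,b) of the free group, let phi v consist of the words p and
   p d_(k,b), where p is a product of letters a_n^-1, b_n^-1 and b is the k-th
   bit of the point obtained from v by applying the f_n along p. Then
   phi (f_n v) = a_n (phi v) `&` b_n (phi v); conversely, if phi u is an
   intersection of translates g (phi v), then g^-1 is in phi v, and comparing
   the letters d_(k,b) shows that g^-1 is one of the words p and that u is the
   point obtained from v along p.

   Lusin-Novikov is proved without ordinals: write the Borel set as the
   projection of a closed set E and consider finite lists of words that extend
   to points of E over a common v, avoiding countably many Borel graphs. There
   are countably many lists, hence one family of graphs which kills every list
   that can be killed. A surviving list can be split at each of its words,
   since otherwise the separation theorem would provide one more graph killing
   it; so, if anything survives, a perfect set of points appears over one v. *)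

Set Implicit Arguments.
Unset Strict Implicit.
Unset Printing Implicit Defensive.

Import Order.TTheory GRing.Theory Num.Theory.
Import numFieldNormedType.Exports.

Local Open Scope classical_set_scope.

(** * Borel and analytic sets in sequence spaces *)

Section SigmaAlgebraPredicates.
Variables (T : Type) (S : set (set T)).
Hypothesis saS : sigma_algebra [set: T] S.

Lemma sigma_not (A : set T) : S A -> S [set x | ~ A x].
Proof.
case: saS => _ SC _ /SC; congr S.
by apply/seteqP; split=> x /=; [case|].
Qed.

Lemma sigma_ex (I : countType) (A : I -> set T) :
  (forall i, S (A i)) -> S [set x | exists i, A i x].
Proof.
case: saS => S0 _ SU SA.
have := SU (fun n => if unpickle n is Some i then A i else set0).
have H n : S (if unpickle n is Some i then A i else set0) by case: unpickle.
move=> /(_ H); congr S; apply/seteqP; split=> x /=.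
  by case=> n _; case: unpickle => [i Aix|//]; exists i.
by case=> i Aix; exists (pickle i) => //; rewrite pickleK.
Qed.

Lemma sigma_all (I : countType) (A : I -> set T) :
  (forall i, S (A i)) -> S [set x | forall i, A i x].
Proof.
move=> SA.
have /sigma_not := sigma_ex (fun i => sigma_not (SA i)); congr S.
apply/seteqP; split=> x /= H; last by case=> i; apply.
by move=> i; apply: contrapT => nA; apply: H; exists i.
Qed.

Lemma sigma_or (A B : set T) : S A -> S B -> S [set x | A x \/ B x].
Proof.
move=> SA SB.
have Sb b : S (if b then A else B) by case: b.
have := @sigma_ex bool (fun b => if b then A else B) Sb.
congr S; apply/seteqP; split=> x /=; first by case=> -[]; [left|right].
by case=> H; [exists true|exists false].
Qed.

Lemma sigma_and (A B : set T) : S A -> S B -> S [set x | A x /\ B x].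
Proof.
move=> SA SB.
have Sb b : S (if b then A else B) by case: b.
have := @sigma_all bool (fun b => if b then A else B) Sb.
congr S; apply/seteqP; split=> x /=.
  by move=> H; split; [exact: (H true)|exact: (H false)].
by case=> ? ? [].
Qed.

Lemma sigma_imp (A B : set T) : S A -> S B -> S [set x | A x -> B x].
Proof.
move=> SA SB; have := sigma_or (sigma_not SA) SB; congr S.
apply/seteqP; split=> x /=; first by case.
by move=> H; case: (pselect (A x)) => [/H|]; [right|left].
Qed.

Lemma sigma_iff (A B : set T) : S A -> S B -> S [set x | A x <-> B x].
Proof. by move=> SA SB; apply: sigma_and; apply: sigma_imp. Qed.

Lemma sigma_prop (P : Prop) : S [set x | P].
Proof.
case: saS => S0 _ _; case: (pselect P) => p.
  rewrite (_ : [set _ | P] = [set x | ~ set0 x]); first exact: sigma_not.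
  by apply/seteqP; split=> x /= *; [case|].
by rewrite (_ : [set _ | P] = set0) //; apply/seteqP; split.
Qed.

Lemma sigma_guard (P : Prop) (A : set T) : (P -> S A) -> S [set x | P -> A x].
Proof.
case: (pselect P) => p => [/(_ p)|_].
  by congr S; apply/seteqP; split=> x /=; [|apply].
by have := sigma_prop True; congr S; apply/seteqP; split=> x //= _ /p.
Qed.

End SigmaAlgebraPredicates.

Lemma smallest_sigma_ind (T : Type) (G S : set (set T)) :
  sigma_algebra [set: T] S -> G `<=` S -> <<s G >> `<=` S.
Proof. by move=> saS GS; apply: smallest_sub. Qed.

(** With [smallest_sigma_ind] this reduces the measurability of preimages under [phi] to a check on
    generators. *)
Lemma sigma_pushforward (T T' : Type) (phi : T -> T') (S : set (set T)) :
  sigma_algebra [set: T] S ->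
  sigma_algebra [set: T'] [set B | S [set x | B (phi x)]].
Proof.
move=> sa; split=> [|A SA|A SA] /=; first exact: (sigma_prop sa False).
  have := sigma_not sa SA; congr S.
  by apply/seteqP; split=> x /=; [split|case].
have := sigma_ex sa SA; congr S; apply/seteqP; split=> x /=.
  by case=> n; exists n.
by case=> n _; exists n.
Qed.

Lemma countable_enum (T : Type) (x0 : T) (A : set T) : countable A ->
  exists y : nat -> T, forall x, A x -> exists n, x = y n.
Proof.
move=> /pfcard_geP [->|[f]]; first by exists (fun=> x0).
by exists f => x /(@surj _ _ _ _ f) [n _ <-]; exists n.
Qed.

Section Prefixes.
Variable L : Type.
Implicit Types (e : nat -> L).

Lemma eq_mkseqP e e' n :
  mkseq e n = mkseq e' n <-> forall k, k < n -> e k = e' k.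
Proof.
split=> [H k kn|H].
  by rewrite -(nth_mkseq (e 0) e kn) H nth_mkseq.
by apply/eq_in_map => k; rewrite mem_iota => /H.
Qed.

(** Closedness in the product of discrete topologies, whose basic open sets are given by finite
    prefixes. *)
Definition closed_seq (F : set (nat -> L)) :=
  forall e, (forall n, exists2 e', F e' & mkseq e' n = mkseq e n) -> F e.

Definition cylinders : set (set (nat -> L)) :=
  [set A | exists k l, A = [set e | e k = l]].

Definition borel_seq : set (set (nat -> L)) := <<s cylinders >>.

Lemma sigma_borel_seq : sigma_algebra [set: nat -> L] borel_seq.
Proof. exact: smallest_sigma_algebra. Qed.

End Prefixes.

Definition continuous_seq (L L' : Type) (h : (nat -> L) -> (nat -> L')) :=
  forall e n, exists m, forall e', mkseq e' m = mkseq e m ->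
    mkseq (h e') n = mkseq (h e) n.

Lemma closed_seq_preimage (L L' : Type) (h : (nat -> L) -> (nat -> L')) F :
  continuous_seq h -> closed_seq F -> closed_seq [set e | F (h e)].
Proof.
move=> ch cF e He; apply: cF => n.
have [m Hm] := ch e n; have [e' Fe' /Hm] := He m.
by exists (h e').
Qed.

Lemma closed_seq_forall (L I : Type) (F : I -> set (nat -> L)) :
  (forall i, closed_seq (F i)) -> closed_seq [set e | forall i, F i e].
Proof.
move=> cF e He i; apply: cF => n; have [e' Fe' ?] := He n.
by exists e'; [exact: Fe'|].
Qed.

Section BorelSeq.
Variable L : countType.

Lemma borel_coord k (R : set L) : borel_seq [set e : nat -> L | R (e k)].
Proof.
have sa := @sigma_borel_seq L.
suff : borel_seq [set e : nat -> L | exists l, R l /\ e k = l].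
  congr borel_seq; apply/seteqP; split=> e /=; first by case=> l [? ->].
  by move=> ?; exists (e k).
apply: (sigma_ex sa) => l; apply: (sigma_and sa).
  exact: sigma_prop.
by apply: sub_sigma_algebra; exists k, l.
Qed.

Lemma borel_prefix n (R : set (seq L)) :
  borel_seq [set e : nat -> L | R (mkseq e n)].
Proof.
have sa := @sigma_borel_seq L.
suff : borel_seq [set e : nat -> L | exists l, R l /\ mkseq e n = l].
  congr borel_seq; apply/seteqP; split=> e /=; first by case=> l [? ->].
  by move=> ?; exists (mkseq e n).
apply: (sigma_ex sa) => w; apply: (sigma_and sa); first exact: sigma_prop.
elim: n w => [|n IH] w.
  exact: (sigma_prop sa ([::] = w)).
case/lastP: w => [|w l].
  have := sigma_prop sa False; congr borel_seq; apply/seteqP; split=> e; first by case.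
  by rewrite /mkset mkseqS; case: (mkseq e n).
have := sigma_and sa (IH w) (borel_coord n (fun x => x = l)).
congr borel_seq; apply/seteqP; split=> e; rewrite /mkset mkseqS.
  by case=> -> ->.
by move=> /rcons_inj [].
Qed.

Lemma borel_closed (F : set (nat -> L)) : closed_seq F -> borel_seq F.
Proof.
move=> cF.
have := sigma_all (@sigma_borel_seq L)
  (fun n => borel_prefix n (fun w => exists2 e', F e' & mkseq e' n = w)).
congr borel_seq; apply/seteqP; split=> e /= H; first exact: cF.
by move=> n; exists e.
Qed.

End BorelSeq.

Definition borel_map (L L' : Type) (h : (nat -> L) -> (nat -> L')) :=
  forall k l, borel_seq [set e | h e k = l].

Lemma borel_preimage (L L' : Type) (h : (nat -> L) -> (nat -> L')) B :
  borel_map h -> borel_seq B -> borel_seq [set e | B (h e)].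
Proof.
move=> bh; move: B.
have sa := @sigma_borel_seq L.
apply: (smallest_sigma_ind (sigma_pushforward h sa)).
by move=> _ [k [l ->]]; exact: bh.
Qed.

(** * Borel sets as projections of closed sets *)

Section Suslin.
Variable L : countType.
Implicit Types B : set (nat -> L).

Definition suslin B := exists F : set (nat -> L * nat), closed_seq F /\
  forall e, B e <-> exists al : nat -> nat, F (fun k => (e k, al k)).

Lemma suslin_closed B : closed_seq B -> suslin B.
Proof.
move=> cB; exists [set e | B (fun k => (e k).1)]; split.
  apply: closed_seq_preimage cB => e n; exists n => e' /eq_mkseqP H.
  by apply/eq_mkseqP => k /H ->.
by move=> e; split=> [Be|[]//]; exists (fun=> 0).
Qed.

(** Entry 0 of the new witness names the index n; the remaining entries are a witness for [B n]. *)
Lemma suslin_bigcup (B : nat -> set (nat -> L)) :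
  (forall n, suslin (B n)) -> suslin (\bigcup_n B n).
Proof.
move=> /(@choice _ _ _) [F /all_and2 [cF FB]].
pose sh (e : nat -> L * nat) k := ((e k).1, (e k.+1).2).
exists [set e | F (e 0).2 (sh e)]; split.
  move=> e He; apply: (cF) => n; have [e' /= Fe' /eq_mkseqP ee'] := He n.+1.
  exists (sh e'); first by rewrite -ee'.
  by apply/eq_mkseqP => k kn; rewrite /sh !ee' // ltnW.
move=> e; split.
  move=> [n _ /FB [al Fal]]; exists (fun k => if k is k'.+1 then al k' else n).
  exact: Fal.
by move=> [al /= Fal]; exists (al 0) => //; apply/FB; exists (fun k => al k.+1).
Qed.

(** The pairing [pickle (n, k)] stores a sequence of witnesses, one for each n, in a single one. *)
Lemma suslin_bigcap (B : nat -> set (nat -> L)) :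
  (forall n, suslin (B n)) -> suslin (\bigcap_n B n).
Proof.
move=> /(@choice _ _ _) [F /all_and2 [cF FB]].
pose row (n : nat) (e : nat -> L * nat) k := ((e k).1, (e (pickle (n, k))).2).
exists [set e | forall n, F n (row n e)]; split.
  apply: closed_seq_forall => n; apply: closed_seq_preimage (cF n) => e m.
  exists (m + \max_(k < m) (pickle (n, nat_of_ord k)).+1) => e' /eq_mkseqP H.
  apply/eq_mkseqP => k km; rewrite /row !H //.
    apply: leq_trans (leq_addl _ _).
    exact: (@leq_bigmax _ (fun k : 'I_m => (pickle (n, nat_of_ord k)).+1) (Ordinal km)).
  exact: leq_trans (leq_addr _ _).
move=> e; split.
  move=> Be; have /(@choice _ _ _) [al Fal] : forall n, exists al, F n (fun k => (e k, al k)).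
    by move=> n; apply/FB/Be.
  exists (fun m => if unpickle m is Some (n, k) then al n k else 0) => n.
  have := Fal n; congr F; apply/funext => k; rewrite /row /=.
  by rewrite pickleK.
move=> [al Fal] n _; apply/FB.
by exists (fun k => al (pickle (n, k))); exact: Fal.
Qed.

(** Complements are built into the induction: the sets that are Suslin together with their
    complement form a sigma-algebra, and a cylinder and its complement are both closed. *)
Lemma borel_suslin B : borel_seq B -> suslin B.
Proof.
suff H : @borel_seq L `<=` [set B | suslin B /\ suslin (~` B)] by move=> /H[].
apply: smallest_sigma_ind.
  split.
  - by split; apply: suslin_closed => e; [case/(_ 0) | move=> _ []].
  - by move=> A [? ?]; rewrite setTD /= setCK.
  - move=> A /all_and2 [A1 A2]; split; first exact: suslin_bigcup.
    by rewrite setC_bigcup; exact: suslin_bigcap.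
move=> _ [k [l ->]]; split; apply: suslin_closed => e /(_ k.+1).
  by move=> [e' /= <- /eq_mkseqP ->].
by move=> [e' /= H /eq_mkseqP /(_ k (ltnSn k)) <-].
Qed.

End Suslin.

(** * Separation of disjoint projections by a Borel set *)

Section Separation.
Variables K K' L : countType.

Definition borel_separated (A B : set (nat -> L)) := exists2 S, borel_seq S &
  A `<=` S /\ B `<=` ~` S.

Section ClosedSeparation.
Variables (p : K -> L) (p' : K' -> L).
Variables (F : set (nat -> K)) (F' : set (nat -> K')).
Hypotheses (cF : closed_seq F) (cF' : closed_seq F').

Let A w := [set z | exists e, [/\ F e, mkseq e (size w) = w & z = p \o e]].
Let A' w := [set z | exists e, [/\ F' e, mkseq e (size w) = w & z = p' \o e]].

(** [A w] is the union over l of the sets [A (rcons w l)], and likewise for [A' w']. If [S (l, l')]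
    separates the pieces, then the union over l of the intersections over l' separates the
    unions. *)
Lemma separated_step w w' :
  (forall l l', borel_separated (A (rcons w l)) (A' (rcons w' l'))) ->
  borel_separated (A w) (A' w').
Proof.
have sa := @sigma_borel_seq L.
move=> H.
have /(@choice _ _ _) [S /= HS] : forall ll : K * K', exists S, [/\ borel_seq S,
    A (rcons w ll.1) `<=` S & A' (rcons w' ll.2) `<=` ~` S].
  by move=> [l l']; have [S bS []] := H l l'; exists S.
exists [set z | exists l, forall l', S (l, l') z].
  apply: (sigma_ex sa) => l; apply: (sigma_all sa) => l'.
  by have [] := HS (l, l').
split=> z.
  move=> [e [Fe we ->]]; exists (e (size w)) => l'.
  have [_ + _] := HS (e (size w), l'); apply; exists e.
  by rewrite size_rcons mkseqS we.
move=> [e [Fe we ->]] [l] /(_ (e (size w'))).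
have [_ _] := HS (l, e (size w')); apply; exists e.
by rewrite size_rcons mkseqS we.
Qed.

(** If separation fails, [separated_step] extends a pair of inseparable words forever. The limits
    lie in [F] and [F'] by closedness, so their projections differ at some k; then a cylinder at k
    separates the pieces given by the words of length k + 1. *)
Lemma closed_separation :
  (forall e e', F e -> F' e' -> p \o e <> p' \o e') ->
  borel_separated [set p \o e | e in F] [set p' \o e | e in F'].
Proof.
have sa := @sigma_borel_seq L.
move=> disj; apply: contrapT => nsep.
pose ns (s : seq K * seq K') := ~ borel_separated (A s.1) (A' s.2).
have ns0 : ns ([::], [::]).
  move=> [S bS [H1 H2]]; apply: nsep; exists S => //; split=> _ [e Fe <-].
    by apply: H1; exists e.
  by apply: H2; exists e.
have step s : ns s -> exists ll, ns (rcons s.1 ll.1, rcons s.2 ll.2).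
  move=> nss; apply: contrapT => /forallNP H; apply: nss.
  by apply: separated_step => l l'; apply: contrapT (H (l, l')).
have [l0 _] := step _ ns0.
have /(@choice _ _ _) [f Hf] : forall s, exists ll, ns s ->
    ns (rcons s.1 ll.1, rcons s.2 ll.2).
  move=> s; have [/step [ll ?]|] := pselect (ns s); first by exists ll.
  by exists l0.
pose s n := iter n (fun s => (rcons s.1 (f s).1, rcons s.2 (f s).2)) ([::], [::]).
have nss n : ns (s n) by elim: n => // n; exact: Hf.
pose e k := (f (s k)).1; pose e' k := (f (s k)).2.
have se n : s n = (mkseq e n, mkseq e' n).
  elim: n => // n IH; rewrite !mkseqS.
  by have -> : s n.+1 = (rcons (s n).1 (e n), rcons (s n).2 (e' n)) by []; rewrite IH.
have Fe : F e.
  apply: cF => n; apply: contrapT => H; apply: (nss n); rewrite se.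
  exists set0; first exact: (sigma_prop sa False).
  split=> [z [d [Fd + _]]|z _ []]; rewrite size_mkseq => de.
  by apply: H; exists d.
have Fe' : F' e'.
  apply: cF' => n; apply: contrapT => H; apply: (nss n); rewrite se.
  exists setT; first exact: (sigma_prop sa True).
  split=> // z [d [Fd + _]]; rewrite size_mkseq => de.
  by case: H; exists d.
apply: (disj _ _ Fe Fe'); apply/funext => k; apply: contrapT => /= nk.
apply: (nss k.+1); rewrite se.
exists [set z | z k = p (e k)]; first exact: (borel_coord k (fun x => x = p (e k))).
split=> z [d [_ + ->]]; rewrite size_mkseq => /eq_mkseqP /(_ k (ltnSn k)) /= -> //.
by move/esym.
Qed.

End ClosedSeparation.
End Separation.

Lemma borel_separation (K L : countType) (p : K -> L) (B B' : set (nat -> K)) :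
  borel_seq B -> borel_seq B' ->
  (forall e e', B e -> B' e' -> p \o e <> p \o e') ->
  borel_separated [set p \o e | e in B] [set p \o e | e in B'].
Proof.
move=> /borel_suslin [F [cF FB]] /borel_suslin [F' [cF' FB']] disj.
have [|S bS [H1 H2]] := @closed_separation _ _ _ (p \o fst) (p \o fst) F F' cF cF'.
  move=> e e' Fe Fe'; apply: (disj (fst \o e) (fst \o e')).
    apply/FB; exists (snd \o e); move: Fe; congr F.
    by apply/funext => k /=; case: (e k).
  apply/FB'; exists (snd \o e'); move: Fe'; congr F'.
  by apply/funext => k /=; case: (e' k).
exists S => //; split=> _ [e + <-].
  by move=> /FB [al Fal]; apply: H1; exists (fun k => (e k, al k)).
by move=> /FB' [al Fal]; apply: H2; exists (fun k => (e k, al k)).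
Qed.

(** * The Lusin-Novikov theorem *)

Lemma borel_letter (K : countType) (q : K -> bool) :
  borel_map (fun (e : nat -> K) k => q (e k)).
Proof. by move=> k l; apply: (borel_coord k (fun x => q x = l)). Qed.

Lemma borel_eq (K L' : countType) (h h' : (nat -> K) -> (nat -> L')) :
  borel_map h -> borel_map h' -> borel_seq [set e | h e = h' e].
Proof.
move=> bh bh'; have sa := @sigma_borel_seq K.
have := sigma_all sa (fun k => sigma_ex sa (fun l => sigma_and sa (bh k l) (bh' k l))).
congr borel_seq; apply/seteqP; split=> e /= H.
  by apply/funext => k; have [l [-> ->]] := H k.
by move=> k; exists (h' e k); rewrite H.
Qed.

Lemma borel_comp (K L' L'' : countType) (h : (nat -> K) -> (nat -> L'))
    (h' : (nat -> L') -> (nat -> L'')) :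
  borel_map h -> borel_map h' -> borel_map (fun e => h' (h e)).
Proof. by move=> bh bh' k l; apply: borel_preimage bh (bh' k l). Qed.

Section LusinNovikov.
Local Notation C := (nat -> bool).
Local Notation L := ((bool * bool) * nat)%type.

Variable E : set (nat -> L).
Hypothesis cE : closed_seq E.

Let l0 : L := ((true, true), 0).
(** A letter carries a bit of u, a bit of v and an entry of the witness of membership. *)
Let U (l : L) := l.1.1.
Let V (l : L) := l.1.2.

Implicit Types (a : seq (seq L)) (G : nat -> C -> C) (gam : nat -> nat -> L).
Implicit Types (u v : C).

(* gam lists size a points of E over the same v, the j-th one extending the
   word a_j, whose u-parts lie on none of the graphs of the G_n. *)
Definition config G a gam v := forall j, j < size a ->
  [/\ E (gam j), mkseq (gam j) (size (nth [::] a j)) = nth [::] a j,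
      V \o gam j = v & forall n, U \o gam j <> G n v].

Lemma config_sub G G' a gam v : (forall n, exists m, G n = G' m) ->
  config G' a gam v -> config G a gam v.
Proof.
move=> GG' H j ja; have [? ? ? Hn] := H j ja; split=> // n.
by have [m ->] := GG' n.
Qed.

(** The v with a configuration whose i-th u-part has m-th bit true, and those with one where it is
    false, form disjoint projections of Borel sets. A Borel set separating them gives the m-th bit
    of [g]. *)
Lemma config_functional G a i : (forall n, borel_map (G n)) -> i < size a ->
  (forall gam gam' v, config G a gam v -> config G a gam' v ->
     U \o gam i = U \o gam' i) ->
  exists2 g : C -> C, borel_map g &
    forall gam v, config G a gam v -> U \o gam i = g v.
Proof.
move=> bG ia fn.
(* A configuration is coded by one sequence of lists, whose k-th list collects the k-th letters of
   all rows. *)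
pose row (e : nat -> seq L) j k := nth l0 (e k) j.
pose p (s : seq L) := V (nth l0 s i).
pose B b m := [set e | config G a (row e) (p \o e) /\ U (row e i m) = b].
have sa := @sigma_borel_seq (seq L).
have brow j : borel_map (row^~ j).
  by move=> k l; apply: (borel_coord k (fun s => nth l0 s j = l)).
have bconf : borel_seq [set e | config G a (row e) (p \o e)].
  apply: (sigma_all sa) => j; apply: (sigma_guard sa) => ja.
  have bp : borel_map (fun e : nat -> seq L => p \o e) by exact: borel_letter.
  have H1 : borel_seq [set e | E (row e j)].
    exact: borel_preimage (brow j) (borel_closed cE).
  have H2 : borel_seq [set e | mkseq (row e j) (size (nth [::] a j)) = nth [::] a j].
    apply: (borel_preimage (brow j) (borel_prefix _ (fun w => w = nth [::] a j))).
  have bV : borel_map (fun e => V \o row e j).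
    by apply: (@borel_letter (seq L) (fun s => V (nth l0 s j))).
  have H3 := borel_eq bV bp.
  have bU : borel_map (fun e => U \o row e j).
    by apply: (@borel_letter (seq L) (fun s => U (nth l0 s j))).
  have H4 : borel_seq [set e | forall n, U \o row e j <> G n (p \o e)].
    by apply: (sigma_all sa) => n; apply: (sigma_not sa); apply: borel_eq bU (borel_comp bp (bG n)).
  have := sigma_and sa (sigma_and sa H1 H2) (sigma_and sa H3 H4).
  by congr borel_seq; apply/seteqP; split=> e /=; [case=> [[? ?] [? ?]]|case].
have bB b m : borel_seq (B b m).
  apply: (sigma_and sa) => //.
  exact: (borel_coord m (fun s => U (nth l0 s i) = b)).
have /(@choice _ _ _) [S HS] : forall m, exists S, [/\ borel_seq S,
    [set p \o e | e in B true m] `<=` S & [set p \o e | e in B false m] `<=` ~` S].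
  move=> m; suff [S ? []] : borel_separated [set p \o e | e in B true m]
      [set p \o e | e in B false m] by exists S.
  apply: borel_separation => // e e' [ce Ue] [ce' Ue'] ee'.
  rewrite -ee' in ce'; have /(congr1 (@^~ m)) /= := fn _ _ _ ce ce'.
  by rewrite Ue Ue'.
exists (fun v m => `[< S m v >]).
  move=> m l; have [bS _ _] := HS m.
  case: l.
    by move: bS; congr borel_seq; apply/seteqP; split=> v /=; [exact: asboolT|exact: asboolW].
  have := sigma_not (@sigma_borel_seq bool) bS; congr borel_seq.
  by apply/seteqP; split=> v /=; [move=> /asboolPn/negbTE|move=> /negbT/asboolPn].
move=> gam v cg.
pose e k := mkseq (fun j => gam j k) (size a).
have re j : j < size a -> row e j = gam j.
  by move=> ja; apply/funext => k; rewrite /row /e nth_mkseq.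
have pe : p \o e = v.
  have [_ _ <- _] := cg i ia; apply/funext => k /=.
  by rewrite /p /e nth_mkseq.
have ce : config G a (row e) (p \o e).
  by move=> j ja; rewrite re // pe; exact: cg.
apply/funext => m /=; have [_ S1 S0] := HS m.
case Um : (U (gam i m)).
  by apply/esym/asboolP; apply: S1; exists e => //; split; rewrite ?re.
by apply/esym/asboolPn; apply: S0; exists e => //; split; rewrite ?re.
Qed.


(** The difference lies inside both words, so it persists in all their extensions. *)
Definition u_incompatible (w w' : seq L) := exists m,
  [/\ m < size w, m < size w' & U (nth l0 w m) <> U (nth l0 w' m)].

Lemma nth_prefix (w w' : seq L) m : prefix w w' -> m < size w ->
  nth l0 w' m = nth l0 w m.
Proof. by move=> /prefixP [t ->] mw; rewrite nth_cat mw. Qed.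

Lemma u_incompatible_prefix (w1 w1' w2 w2' : seq L) :
  prefix w1 w2 -> prefix w1' w2' ->
  u_incompatible w1 w1' -> u_incompatible w2 w2'.
Proof.
move=> p12 p12' [m [m1 m1' H]]; exists m; split.
- exact: leq_trans m1 (size_prefix p12).
- exact: leq_trans m1' (size_prefix p12').
- by rewrite (nth_prefix p12) // (nth_prefix p12').
Qed.

(** * Splitting the words of a surviving list *)

Section Splitting.
Variable G : nat -> C -> C.
Hypothesis bG : forall n, borel_map (G n).
(* Holds for an enumeration of witnesses chosen for each of the countably many
   lists of words a that admit one. *)
Hypothesis Gmax : forall a G', (forall n, borel_map (G' n)) ->
  (forall gam v, ~ config G' a gam v) -> forall gam v, ~ config G a gam v.

Definition good a := exists gam v, config G a gam v.

(** If the i-th u-part were a function of v, adding its Borel graph to [G] would kill [a], contrary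
    to [Gmax]. So two configurations over one v differ at i; the rows of the first are kept and the
    i-th row of the second is appended. *)
Lemma good_split a i N : good a -> i < size a -> exists a',
  [/\ good a', size a' = (size a).+1, forall w, w \in a' -> N <= size w &
   [/\ forall j, j < size a -> prefix (nth [::] a j) (nth [::] a' j),
       prefix (nth [::] a i) (nth [::] a' (size a))
     & u_incompatible (nth [::] a' i) (nth [::] a' (size a))]].
Proof.
move=> [gam0 [v0 c0]] ia.
have [gam [gam' [v [c c' dif]]]] : exists gam gam' v,
    [/\ config G a gam v, config G a gam' v & U \o gam i <> U \o gam' i].
  apply: contrapT => H.
  have [|g bg Hg] := config_functional bG ia.
    move=> gam gam' v c c'; apply: contrapT => d; apply: H.
    by exists gam, gam', v.
  pose G' n := if n is n'.+1 then G n' else g.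
  apply: (Gmax (a := a) (G' := G')) c0 => [n|gam v c].
    by case: n => [|n]; [exact: bg|exact: bG].
  have c' : config G a gam v by apply: config_sub c => n; exists n.+1.
  by have [_ _ _ /(_ 0)] := c i ia; apply; rewrite (Hg _ _ c').
have [m Hm] : exists m, U (gam i m) <> U (gam' i m).
  apply: contrapT => /forallNP H; apply: dif; apply/funext => m.
  by apply: contrapT (H m).
(* Long enough to show the difference at m, to reach length N and to extend every word of [a]. *)
pose M := maxn m.+1 (maxn N (\max_(j < size a) size (nth [::] a j))).
have leM j : j < size a -> size (nth [::] a j) <= M.
  move=> ja; rewrite /M !leq_max; apply/orP; right; apply/orP; right.
  exact: (@leq_bigmax _ (fun j : 'I__ => size (nth [::] a j)) (Ordinal ja)).
pose gam'' j := if j < size a then gam j else gam' i.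
pose a' := mkseq (fun j => mkseq (gam'' j) M) (size a).+1.
have na' j : j < (size a).+1 -> nth [::] a' j = mkseq (gam'' j) M.
  by move=> ja; rewrite nth_mkseq.
have pref w f : mkseq f (size w) = w -> size w <= M -> prefix w (mkseq f M).
  move=> <-; rewrite size_mkseq => sM; rewrite prefixE size_mkseq.
  by rewrite /mkseq -map_take take_iota (minn_idPl sM).
exists a'; split.
- exists gam'', v => j; rewrite size_mkseq => ja.
  rewrite na' // size_mkseq /gam''; case: ltnP => ja'.
    by have [] := c j ja'.
  by have [] := c' i ia.
- by rewrite size_mkseq.
- by move=> w /mapP [j _ ->]; rewrite size_mkseq /M !leq_max leqnn orbT.
- split.
  + move=> j ja; rewrite na' ?ltnS 1?ltnW // /gam'' ja.
    by apply: pref (leM _ ja); have [] := c j ja.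
  + rewrite na' // /gam'' ltnn.
    by apply: pref (leM _ ia); have [] := c' i ia.
  + rewrite (na' _ (leqW ia)) (na' _ (ltnSn _)) /gam'' ia ltnn.
    have mM : m < M by rewrite /M leq_max leqnn.
    by exists m; rewrite !size_mkseq !nth_mkseq.
Qed.

(** The words are split one at a time. Later splits only extend words, which preserves prefixes and
    incompatibilities. *)
Lemma good_split_upto a N k : good a -> k <= size a -> exists a',
  [/\ good a', size a' = size a + k, forall j, j < k -> N <= size (nth [::] a' j)
       /\ N <= size (nth [::] a' (size a + j)) &
   [/\ forall j, j < size a -> prefix (nth [::] a j) (nth [::] a' j),
       forall j, j < k -> prefix (nth [::] a j) (nth [::] a' (size a + j))
     & forall j, j < k ->
        u_incompatible (nth [::] a' j) (nth [::] a' (size a + j))]].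
Proof.
move=> ga; elim: k => [_|k IH ka].
  by exists a; split=> //; [rewrite addn0|split=> // j _; exact: prefix_refl].
have [a' [ga' sa' _ [p1 p2 i3]]] := IH (ltnW ka).
have ka' : k < size a' by rewrite sa' ltn_addr.
have [b [gb sb Nb [q1 q2 i4]]] := good_split N ga' ka'.
have la' j : j < size a -> j < size a' by move=> ?; rewrite sa' ltn_addr.
have la'' j : j < k -> size a + j < size a' by rewrite sa' ltn_add2l.
have szb j : j < k.+1 -> size a + j < size b.
  by rewrite sb sa' !ltnS leq_add2l.
exists b; split=> //.
- by rewrite sb sa' addnS.
- move=> j jk; split; apply/Nb/mem_nth; last exact: szb.
  by apply: leq_trans (szb _ jk); rewrite ltnS leq_addl.
- split=> [j ja|j|j].
  + by apply: prefix_trans (p1 _ ja) (q1 _ (la' _ ja)).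
  + rewrite ltnS leq_eqVlt => /orP[/eqP ->|jk].
      by rewrite -sa'; apply: prefix_trans (p1 _ ka) q2.
    by apply: prefix_trans (p2 _ jk) (q1 _ (la'' _ jk)).
  + rewrite ltnS leq_eqVlt => /orP[/eqP ->|jk]; first by rewrite -sa'.
    apply: u_incompatible_prefix (i3 _ jk); apply: q1; last exact: la''.
    exact/la'/(ltn_trans jk).
Qed.

Lemma good_double a N : good a -> exists a',
  [/\ good a', size a' = size a + size a,
      forall j, j < size a' -> N <= size (nth [::] a' j) &
   forall j, j < size a ->
     [/\ prefix (nth [::] a j) (nth [::] a' j),
         prefix (nth [::] a j) (nth [::] a' (size a + j))
       & u_incompatible (nth [::] a' j) (nth [::] a' (size a + j))]].
Proof.
move=> ga; have [a' [ga' sa' Na' [p1 p2 i3]]] := good_split_upto N ga (leqnn _).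
exists a'; split=> // [j|j ja].
  rewrite sa'; case: (ltnP j (size a)) => [ja _|ja jaa]; first by have [] := Na' _ ja.
  rewrite -(subnKC ja); have [//|_ //] := Na' (j - size a).
  by rewrite ltn_subLR.
by split; [exact: p1|exact: p2|exact: i3].
Qed.

Hypothesis countable_section : forall v,
  countable [set U \o e | e in [set e | E e /\ V \o e = v]].

(* Repeated doubling yields a perfect tree of points over a single v, and some
   branch of it escapes any enumeration of the section at v. *)
Lemma not_good : ~ good [:: [::]].
Proof.
move=> g0.
have /(@choice _ _ _) [D HD] : forall na : nat * seq (seq L), exists a', good na.2 ->
  [/\ good a', size a' = size na.2 + size na.2,
      forall j, j < size a' -> na.1 <= size (nth [::] a' j) &
   forall j, j < size na.2 ->
     [/\ prefix (nth [::] na.2 j) (nth [::] a' j),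
         prefix (nth [::] na.2 j) (nth [::] a' (size na.2 + j))
       & u_incompatible (nth [::] a' j) (nth [::] a' (size na.2 + j))]].
  move=> [n a] /=; have [/(good_double n) [a' ?]|] := pselect (good a).
    by exists a'.
  by exists [::].
pose A := fix A n := if n is n'.+1 then D (n, A n') else [:: [::]].
have gA n : good (A n) by elim: n => // n IH; have [] := HD (n.+1, A n) IH.
have sA n : size (A n) = 2 ^ n.
  elim: n => // n IH; have [_ /= -> _ _] := HD (n.+1, A n) (gA n).
  by rewrite IH addnn expnS mul2n.
have lA n j : j < 2 ^ n -> n <= size (nth [::] (A n) j).
  case: n => // n; rewrite -sA => jn.
  by have [_ _ /(_ j jn) /=] := HD (n.+1, A n) (gA n).
have HA n j : j < 2 ^ n ->
     [/\ prefix (nth [::] (A n) j) (nth [::] (A n.+1) j),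
         prefix (nth [::] (A n) j) (nth [::] (A n.+1) (2 ^ n + j))
       & u_incompatible (nth [::] (A n.+1) j) (nth [::] (A n.+1) (2 ^ n + j))].
  by rewrite -sA => jn; have [_ _ _ /(_ j jn) /=] := HD (n.+1, A n) (gA n).
(* A branch is given by its position b n in each level of the tree: the successors of position j of
   level n are j and [2 ^ n + j]. *)
pose branch (b : nat -> nat) := b 0 = 0 /\
  forall n, b n.+1 = b n \/ b n.+1 = 2 ^ n + b n.
pose word (b : nat -> nat) n := nth [::] (A n) (b n).
(* Level k + 1 is the first whose words are certain to have a k-th letter. *)
pose lim (b : nat -> nat) k := nth l0 (word b k.+1) k.
have blt b n : branch b -> b n < 2 ^ n.
  move=> [b0 bS]; elim: n => [|n IH]; first by rewrite b0.
  by rewrite expnS mul2n -addnn; case: (bS n) => ->; rewrite ?ltn_add2l // ltn_addr.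
have bpref b n d : branch b -> prefix (word b n) (word b (n + d)).
  move=> bb; elim: d => [|d IH]; first by rewrite addn0 prefix_refl.
  apply: prefix_trans IH _; rewrite addnS /word.
  have [H1 H2 _] := HA _ _ (blt _ (n + d) bb).
  by case: (bb.2 (n + d)) => ->.
have limE b n k : branch b -> k < n -> lim b k = nth l0 (word b n) k.
  move=> bb kn; rewrite /lim -(subnKC kn); apply/esym/nth_prefix; first exact: bpref.
  exact: lA (blt _ _ bb).
have mklim b n : branch b -> mkseq (lim b) n = take n (word b n).
  move=> bb; apply: (@eq_from_nth _ l0).
    by rewrite size_mkseq size_take_min; apply/esym/minn_idPl/lA/blt.
  move=> k; rewrite size_mkseq => kn.
  by rewrite nth_mkseq // nth_take // (limE _ n).
have Elim b : branch b -> E (lim b).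
  move=> bb; apply: cE => n; have [gam [v c]] := gA n.
  have [|Eg wg _ _] := c (b n); first by rewrite sA blt.
  exists (gam (b n)) => //; rewrite mklim // /word -wg.
  rewrite /mkseq -map_take take_iota (minn_idPl _) //.
  exact: lA (blt _ _ bb).
have Vlim b b' : branch b -> branch b' -> V \o lim b = V \o lim b'.
  move=> bb bb'; apply/funext => k /=; have [gam [v c]] := gA k.+1.
  suff H b'' : branch b'' -> V (lim b'' k) = v k by rewrite !H.
  move=> bb''; have [|_ wg <- _] := c (b'' k.+1); first by rewrite sA blt.
  rewrite /lim /word -wg /= nth_mkseq //.
  exact: lA (blt _ _ bb'').
have b00 : branch (fun=> 0) by split=> // n; left.
pose v := V \o lim (fun=> 0).
have [y Hy] := countable_enum (fun=> true) (countable_section v).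
pose compat (w : seq L) (z : C) := forall m, m < size w -> U (nth l0 w m) = z m.
(* Diagonalization: the two successors are incompatible, so one of them disagrees with [y n'], and
   the branch goes there. *)
pose b := fix b n := if n is n'.+1 then
   (if `[< compat (nth [::] (A n) (b n')) (y n') >] then 2 ^ n' + b n' else b n')
   else 0.
have bb : branch b.
  by split=> // n /=; case: ifP => _; [right|left].
have ncompat n : ~ compat (word b n.+1) (y n).
  have [_ _ [m [m1 m2 dif]]] := HA n (b n) (blt _ n bb).
  rewrite /word; have -> : b n.+1 =
   (if `[< compat (nth [::] (A n.+1) (b n)) (y n) >] then 2 ^ n + b n else b n) by [].
  case: asboolP => // c1 c2; apply: dif.
  by rewrite c1 // c2.
have [|n Hn] := Hy (U \o lim b).
  by exists (lim b) => //; split; [exact: Elim|exact: Vlim].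
apply: (ncompat n) => m mw.
have -> : y n m = U (lim b m) by rewrite -Hn.
case: (ltnP m n.+1) => mn; first by rewrite (limE _ n.+1).
rewrite /lim; congr U; apply/esym/nth_prefix => //.
rewrite -(subnKC (leqW mn)); exact: bpref.
Qed.

End Splitting.

(** [Gs a] kills [a] whenever some family does, and [G] enumerates all these families, so it
    satisfies [Gmax]. A point of [E] on none of the graphs would be a configuration for the list of
    one empty word, contrary to [not_good]. *)
Lemma closed_lusin_novikov :
  (forall v, countable [set U \o e | e in [set e | E e /\ V \o e = v]]) ->
  exists G : nat -> C -> C, (forall n, borel_map (G n)) /\
    forall e, E e -> exists n, U \o e = G n (V \o e).
Proof.
move=> ct.
pose dflt (n : nat) (v : C) := v.
have bdflt n : borel_map (dflt n).
  by move=> k l; apply: (borel_coord k (fun x => x = l)).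
have /(@choice _ _ _) [Gs HGs] : forall a, exists G, (forall n, borel_map (G n)) /\
  forall G', (forall n, borel_map (G' n)) -> (forall gam v, ~ config G' a gam v) ->
    forall gam v, ~ config G a gam v.
  move=> a; have [[G [bG HG]]|H] := pselect (exists G,
    (forall n, borel_map (G n)) /\ forall gam v, ~ config G a gam v).
    by exists G.
  by exists dflt; split=> // G' bG' HG'; case: H; exists G'.
pose G n : C -> C := if unpickle n is Some (a, m) then Gs a m else dflt 0.
have bG n : borel_map (G n).
  by rewrite /G; case: unpickle => // -[a m]; have [] := HGs a.
exists G; split=> // e Ee; apply: contrapT => /forallNP He.
apply: (@not_good G) => //.
  move=> a G' bG' HG' gam v c; have [_ /(_ G' bG' HG' gam v)] := HGs a; apply.
  apply: config_sub c => m; exists (pickle (a, m)).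
  by rewrite /G pickleK.
by exists (fun=> e), (V \o e) => -[].
Qed.

End LusinNovikov.

Theorem lusin_novikov (P : set (nat -> bool * bool)) : borel_seq P ->
  (forall v : nat -> bool, countable [set u : nat -> bool | P (fun k => (u k, v k))]) ->
  exists G : nat -> (nat -> bool) -> (nat -> bool), (forall n, borel_map (G n)) /\
    forall u v, P (fun k => (u k, v k)) -> exists n, u = G n v.
Proof.
move=> /borel_suslin [E [cE PE]] ct.
have [|G [bG HG]] := closed_lusin_novikov cE.
  move=> v; apply: sub_countable (ct v); apply: subset_card_le => _ [e [Ee <-] <-] /=.
  apply/PE; exists (snd \o e); move: Ee; congr E; apply/funext => k /=.
  by case: (e k) => -[].
exists G; split=> // u v /PE [al /HG [n Hn]].
by exists n.
Qed.

(** * The standard Borel space of infinite subsets of Finf *)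

Lemma half_pow_lt (R : realType) (e : R) : (0 < e)%R ->
  exists N, (2^-1 ^+ N < e)%R.
Proof.
move=> e0.
have /cvgrPdist_lt /(_ e e0) [N _ HN] : (2^-1 ^+ n)%R @[n --> \oo] --> (0 : R)%R.
  by apply: cvg_expr; rewrite gtr0_norm ?invr_gt0 // invf_lt1 // ltr1n.
exists N; have := HN N (leqnn N).
by rewrite /= sub0r normrN gtr0_norm // exprn_gt0 // invr_gt0.
Qed.

(** * The metric of the Baire space on a set coded by sequences *)

Section SeqMetric.
Variables (R : realType) (T : pointedType) (h : T -> nat -> nat).

Definition seq_dist (x y : T) : R :=
  if pselect (exists n, h x n != h y n) is left p then (2^-1 ^+ ex_minn p)%R
  else 0%R.

Lemma seq_dist_ltP x y N :
  (seq_dist x y < 2^-1 ^+ N)%R <-> forall k, (k <= N)%N -> h x k = h y k.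
Proof.
have h01 : (0 < (2^-1 : R) < 1)%R by rewrite invr_gt0 ltr0n /= invf_lt1 ?ltr0n // ltr1n.
rewrite /seq_dist; case: pselect => [p|np].
  case: ex_minnP => m hm mmin.
  have [h0 h1] := andP h01.
  rewrite ltr_iXn2l //; split=> [Nm k kN|H].
    apply: contrapT => /eqP /mmin; rewrite leqNgt; apply/negP; rewrite negbK.
    exact: leq_ltn_trans kN Nm.
  by rewrite ltnNge; apply/negP => /H/eqP; rewrite (negbTE hm).
split=> [_ k _|_]; last by rewrite exprn_gt0 //; case/andP: h01.
by apply: contrapT => /eqP H; apply: np; exists k.
Qed.

Lemma seq_dist_ge0 x y : (0 <= seq_dist x y)%R.
Proof.
by rewrite /seq_dist; case: pselect => // p; rewrite exprn_ge0 // invr_ge0 ler0n.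
Qed.

Lemma seq_distxx x : seq_dist x x = 0%R.
Proof. by rewrite /seq_dist; case: pselect => // p; exfalso; case: p => n; rewrite eqxx. Qed.

Lemma seq_dist_sym x y : seq_dist x y = seq_dist y x.
Proof.
rewrite /seq_dist; case: pselect => [p|p]; case: pselect => [q|q] //.
- congr (_ ^+ _)%R; apply: eq_ex_minn => n; by rewrite eq_sym.
- by case: q; case: p => n; rewrite eq_sym; exists n.
- by case: p; case: q => n; rewrite eq_sym; exists n.
Qed.

Lemma seq_dist_triangle y x z :
  (seq_dist x z <= seq_dist x y + seq_dist y z)%R.
Proof.
rewrite {1}/seq_dist; case: pselect => [p|_]; last by rewrite addr_ge0 // seq_dist_ge0.
case: ex_minnP => m hm _.
have [xy|xy] := leP (2^-1 ^+ m)%R (seq_dist x y).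
  by rewrite (le_trans xy) // lerDl seq_dist_ge0.
have [yz|yz] := leP (2^-1 ^+ m)%R (seq_dist y z).
  by rewrite (le_trans yz) // lerDr seq_dist_ge0.
by move: hm; rewrite ((seq_dist_ltP x y m).1 xy m) // ((seq_dist_ltP y z m).1 yz m) // eqxx.
Qed.

Hypothesis h_inj : injective h.

Lemma seq_dist_positivity x y : seq_dist x y = 0%R -> x = y.
Proof.
rewrite /seq_dist; case: pselect => [p|np _].
  by move/eqP; rewrite expf_eq0 invr_eq0 pnatr_eq0 andbF.
apply: h_inj; apply/funext => k; apply: contrapT => /eqP H.
by apply: np; exists k.
Qed.

(** A copy of [T] whose type mentions [R] and the injectivity proof, so that the metric structure
    can depend on them. *)
Definition seq_metric of realType & injective h : Type := T.
Local Notation M := (seq_metric R h_inj).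

HB.instance Definition _ := Choice.on M.
HB.instance Definition _ := isMetric.Build R M
  seq_distxx seq_dist_positivity seq_dist_sym seq_dist_triangle.

Lemma seq_metric_ballP (x y : M) N :
  ball x (2^-1 ^+ N)%R y <-> forall k, (k <= N)%N -> h x k = h y k.
Proof. by rewrite ballEmdist; exact: seq_dist_ltP. Qed.

Lemma seq_metric_nbhsP (x : M) (A : set M) : nbhs x A <->
  exists n, forall y : M, (forall k, (k < n)%N -> h x k = h y k) -> A y.
Proof.
split=> [/nbhs_ballP [e /= e0 Be]|[n Hn]].
  have [N HN] := half_pow_lt e0.
  exists N.+1 => y xy; apply: Be; apply: (@le_ball _ _ _ (2^-1 ^+ N)%R).
    exact: ltW.
  by apply/seq_metric_ballP => k kN; exact: xy.
apply/nbhs_ballP; exists (2^-1 ^+ n)%R; first by rewrite /= exprn_gt0 // invr_gt0.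
by move=> y /seq_metric_ballP H; apply: Hn => k /ltnW; exact: H.
Qed.

(** One point for each realizable finite word gives a countable dense set. Along a Cauchy filter
    every coordinate stabilizes, and the limit sequence is a code because the range is closed. *)
Lemma seq_metric_polish : closed_seq (range h) -> polish M.
Proof.
move=> ch; split.
  have /(@choice _ _ _) [F HF] : forall w : seq nat, exists t,
      (exists t, mkseq (h t) (size w) = w) -> mkseq (h t) (size w) = w.
    move=> w; have [[t ?]|] := pselect (exists t, mkseq (h t) (size w) = w).
      by exists t.
    by exists point.
  exists (range F : set M); first exact: card_le_trans (card_image_le F _) (countableP _).
  move=> O [x Ox]; rewrite openE => /(_ x Ox) /seq_metric_nbhsP [n Hn].
  pose w := mkseq (h x) n.
  exists (F w); split; last by exists w.
  apply: Hn; apply/eq_mkseqP.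
  have := HF w; rewrite size_mkseq => -> //.
  by exists x.
move=> F FF /cauchy_ballP cF.
have /(@choice _ _ _) [x Hx] : forall N, exists x : M,
    F [set y | forall k, (k <= N)%N -> h x k = h y k].
  move=> N; have [|[A B] /= [FA FB] AB] := cF (2^-1 ^+ N)%R.
    by rewrite exprn_gt0 // invr_gt0.
  have [x Ax] := filter_ex FA; exists x; apply: filterS FB => y By.
  by apply/seq_metric_ballP; exact: (AB (x, y)).
pose e k := h (x k) k.
have Fe n : F [set y | forall k, (k < n)%N -> h y k = e k].
  elim: n => [|n IH]; first by apply: filterS (@filterT _ F _).
  apply: filterS (filterI IH (Hx n)) => y [/= H1 H2] k.
  by rewrite ltnS leq_eqVlt => /orP[/eqP ->|/H1 //]; rewrite -H2.
have [t _ te] : range h e.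
  apply: ch => n; have [y /= Hy] := filter_ex (Fe n).
  by exists (h y); [exists y|apply/eq_mkseqP].
exists t => A /seq_metric_nbhsP [n Hn]; apply: filterS (Fe n) => y Hy.
by apply: Hn => k kn; rewrite te Hy.
Qed.

(** An open set is the union of the countably many cylinders that it contains. *)
Lemma seq_metric_borel (A : set M) : <<s @open M >> A <->
  <<s [set A | exists n m, A = [set x : T | h x n = m]] >> A.
Proof.
set G := [set A | _].
have sa : sigma_algebra setT (<<s G >>) by exact: smallest_sigma_algebra.
split.
  apply: smallest_sub => // O; rewrite openE => oO.
  have : <<s G >> [set x | exists w, (forall y : M, mkseq (h y) (size w) = w -> O y) /\
       forall n, (n < size w)%N -> h x n = nth 0%N w n].
    apply: (sigma_ex sa) => w; apply: (sigma_and sa); first exact: (sigma_prop sa).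
    apply: (sigma_all sa) => n; apply: (sigma_guard sa) => _.
    by apply: sub_sigma_algebra; exists n, (nth 0%N w n).
  congr (<<s _ >>); apply/seteqP; split=> x /=.
    move=> [w [H xw]]; apply: H; apply: (@eq_from_nth _ 0%N); rewrite size_mkseq //.
    by move=> k kw; rewrite nth_mkseq // xw.
  move=> /oO /seq_metric_nbhsP [n Hn]; exists (mkseq (h x) n).
  rewrite size_mkseq; split=> [y /eq_mkseqP H|k kn]; last by rewrite nth_mkseq.
  by apply: Hn => k kn; rewrite H.
apply: smallest_sub; first exact: smallest_sigma_algebra.
move=> _ [n [m ->]]; apply: sub_sigma_algebra; rewrite openE => x /= xm.
apply/seq_metric_nbhsP; exists n.+1 => y H /=.
by rewrite -H.
Qed.

End SeqMetric.

Lemma standard_borel_closed_code (R : realType) (d : measure_display)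
    (X : measurableType d) (h : X -> nat -> nat) :
  injective h -> closed_seq (range h) ->
  (forall A : set X, measurable A <->
    <<s [set A | exists n m, A = [set x : X | h x n = m]] >> A) ->
  standard_borel R X.
Proof.
move=> h_inj ch mh; exists (seq_metric R h_inj), id; split.
- exact: seq_metric_polish.
- by exists id.
- move=> A; rewrite image_id; apply: (iff_trans (mh A)); apply: iff_sym.
  exact: seq_metric_borel.
Qed.

(** * The Borel structure of the space of infinite subsets *)

Lemma ptws_open_cylinder (I : eqType) (O : set {ptws I -> bool}) f :
  open O -> O f -> exists s : seq I,
    forall g : I -> bool, (forall x, x \in s -> g x = f x) -> O g.
Proof.
move=> oO Of.
(* The filter generated by the basic cylinders around [f]; its convergence to [f] can be tested
   coordinatewise. *)
pose F : set_system {ptws I -> bool} := [set A | exists s : seq I,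
  forall g : I -> bool, (forall x, x \in s -> g x = f x) -> A g].
have FF : Filter F.
  split.
  - by exists [::].
  - move=> A B [s Hs] [t Ht]; exists (s ++ t) => g Hg; split;
      [apply: Hs|apply: Ht] => x xs; apply: Hg; by rewrite mem_cat xs ?orbT.
  - by move=> A B AB [s Hs]; exists s => g /Hs/AB.
suff : F --> f by apply; apply: open_nbhs_nbhs.
apply/cvg_sup => i A [B [[C oC <-] /= Cf] CA].
by exists [:: i] => g Hg; apply: CA; rewrite /= Hg ?inE.
Qed.

Lemma ptws_open_eval (I : eqType) (x : I) b :
  open [set f : {ptws I -> bool} | f x = b].
Proof.
rewrite (_ : [set _ | _] = @proj I (fun=> bool) x @^-1` [set b]) //.
apply: open_comp; last exact: discrete_open.
by move=> f _; exact: proj_continuous.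
Qed.

Lemma sigma_measurable (d : measure_display) (X : measurableType d) :
  sigma_algebra [set: X] measurable.
Proof.
split; first exact: measurable0.
  by move=> A mA; rewrite setTD; exact: measurableC.
by move=> A mA; exact: bigcup_measurable.
Qed.

Lemma measurable_omega_mem x : measurable [set A : OmegaFinf | set_val A x].
Proof.
exists [set A : powersetType Finf | A x]; last by rewrite setTI.
exists [set f : two_pow Finf | f x = true].
  apply: sub_sigma_algebra; exact: (@ptws_open_eval Finf x true).
rewrite setTI; apply/seteqP; split=> A /=; rewrite /charfun.
  by move/asboolW.
exact: asboolT.
Qed.

Lemma measurable_omega_ind (S : set (set OmegaFinf)) :
  sigma_algebra setT S -> (forall x, S [set A | set_val A x]) ->
  measurable `<=` S.
Proof.
move=> sa Sx _ [_ [W mW <-] <-]; rewrite !setTI; move: W mW.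
apply: (smallest_sigma_ind
  (sigma_pushforward (fun A : OmegaFinf => charfun (set_val A)) sa)).
move=> O oO.
have : S [set A : OmegaFinf | exists s : seq (Finf * bool),
    (forall g : Finf -> bool, (forall q, q \in s -> g q.1 = q.2) -> O g) /\
    forall q, q \in s -> (set_val A q.1 <-> q.2)].
  apply: (sigma_ex sa) => s; apply: (sigma_and sa); first exact: (sigma_prop sa).
  apply: (sigma_all sa) => q; apply: (sigma_guard sa) => _.
  by apply: (sigma_iff sa); [exact: Sx|exact: (sigma_prop sa)].
congr S; apply/seteqP; split=> A /=.
  move=> [s [+ As]]; apply=> q /As H; rewrite /charfun.
  by case: q.2 H => H; [apply: asboolT; apply/H|apply/negbTE/asboolPn => /H].
move=> /(ptws_open_cylinder oO) [s Hs].
exists [seq (x, charfun (set_val A) x) | x <- s]; split.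
  by move=> g Hg; apply: Hs => x xs; apply: (Hg (x, _)); apply: map_f.
move=> _ /mapP [x xs ->] /=; rewrite /charfun; split; first exact: asboolT.
exact: asboolW.
Qed.

Section NextElement.
Local Notation Omega := OmegaFinf_set.
Implicit Types (A : Omega).

Definition has_code A m := exists2 x : Finf, set_val A x & pickle x = m.

Lemma infinite_codeP (B : set Finf) :
  infinite_set B <-> forall n, exists2 x, B x & n <= pickle x.
Proof.
split=> [iB n|H /finite_seqP [s Bs]].
  apply: contrapT => H; apply: iB.
  apply: (@sub_finite_set _ _ (@pickle Finf @^-1` `I_n)).
    by move=> x Bx /=; rewrite ltnNge; apply/negP => nx; apply: H; exists x.
  by apply: finite_preimage => // x y _ _; exact: pcan_inj pickleK _ _.
have [x + ] := H (\max_(x <- s) pickle x).+1.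
rewrite Bs /= => xs; rewrite ltnNge => /negP; apply.
exact: leq_bigmax_seq.
Qed.

Lemma has_code_ge A n : exists m, (n <= m) && `[< has_code A m >].
Proof.
have /infinite_codeP /(_ n) [x Ax nx] : infinite_set (set_val A : set Finf).
  by case: A => B iB; exact: (set_mem iB).
by exists (pickle x); rewrite nx; apply/asboolP; exists x.
Qed.

(* A |-> next_code A identifies the infinite subsets of Finf with a closed
   subset of the Baire space. *)
Definition next_code A n := ex_minn (has_code_ge A n).

Lemma next_codeP A n m : next_code A n = m <->
  [/\ n <= m, has_code A m & forall k, n <= k < m -> ~ has_code A k].
Proof.
rewrite /next_code; case: ex_minnP => i /andP[ni /asboolP Ai] imin.
split=> [<-|[nm Am mmin]].
  split=> // k /andP[nk ki] /asboolT Ak.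
  by have := imin k; rewrite nk Ak leqNgt ki => /(_ isT).
apply/eqP; rewrite eqn_leq imin; last by rewrite nm asboolT.
rewrite leqNgt; apply/negP => im.
by apply: (mmin i) => //; rewrite ni.
Qed.

Lemma next_code_memP A x :
  next_code A (pickle x) = pickle x <-> set_val A x.
Proof.
split=> [/next_codeP [_ [y Ay /(pcan_inj pickleK) <-] _] //|Ax].
apply/next_codeP; split=> //; first by exists x.
by move=> k /andP[xk]; rewrite ltnNge xk.
Qed.

Lemma next_code_inj : injective next_code.
Proof.
move=> A B AB; apply: val_inj; apply/seteqP; split=> x;
  by move=> /next_code_memP H; apply/next_code_memP; rewrite ?AB // -AB.
Qed.

Lemma closed_next_code : closed_seq (range next_code).
Proof.
move=> e He.
have approx n k : exists A, next_code A n = e n /\ next_code A k = e k.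
  have [_ [A _ <-] /eq_mkseqP H] := He (maxn n k).+1.
  by exists A; split; apply: H; rewrite ltnS leq_max leqnn ?orbT.
(* The codes of members are exactly the fixed points of [next_code], so [B] is the only candidate.
   [approx] realizes any two entries of [e] by an actual infinite set, which suffices to verify
   it. *)
pose B := [set x : Finf | e (pickle x) = pickle x].
have eB n : exists2 x, B x & pickle x = e n.
  have [A [An Aen]] := approx n (e n).
  have [_ [x Ax xe] _] := (next_codeP A n (e n)).1 An.
  exists x => //; rewrite /B /= xe -Aen -xe.
  exact/next_code_memP.
have en n : n <= e n.
  by have [A [/next_codeP [] ]] := approx n n.
have iB : infinite_set B.
  by apply/infinite_codeP => n; have [x Bx xe] := eB n; exists x; rewrite ?xe.
exists (exist (fun D => D \in @infinite_subsets Finf) B (mem_set iB)) => //.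
apply/funext => n; apply/next_codeP; split; first exact: en.
  by have [x Bx xe] := eB n; exists x; [exact: Bx|].
move=> k /andP[nk ke] [x Bx xk].
have [A [An Ak]] := approx n k.
have [_ _ /(_ k)] := (next_codeP A n (e n)).1 An.
rewrite nk ke => /(_ isT); apply; exists x => //.
by apply/next_code_memP; rewrite xk Ak -xk.
Qed.

End NextElement.

(** Membership of x is the event that [next_code] fixes [pickle x]; conversely, each value of
    [next_code] is decided by countably many membership conditions. *)
Lemma standard_borel_omega (R : realType) : standard_borel R OmegaFinf.
Proof.
have sa := @sigma_measurable _ OmegaFinf.
apply: (@standard_borel_closed_code _ _ OmegaFinf next_code).
- exact: next_code_inj.
- exact: closed_next_code.
move=> A; split.
  apply: measurable_omega_ind; first exact: smallest_sigma_algebra.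
  move=> x; apply: sub_sigma_algebra; exists (pickle x), (pickle x).
  by apply/seteqP; split=> B /= /next_code_memP.
apply: smallest_sub => // _ [n [m ->]].
have mc k : measurable [set B : OmegaFinf | has_code B k].
  suff : measurable [set B : OmegaFinf | exists x, set_val B x /\ pickle x = k].
    congr measurable; apply/seteqP; split=> B [x].
      by case=> ? ?; exists x.
    by exists x.
  apply: (sigma_ex sa) => x; apply: (sigma_and sa); last exact: (sigma_prop sa).
  exact: measurable_omega_mem.
suff : measurable [set B : OmegaFinf | (n <= m /\ has_code B m) /\
    forall k, n <= k < m -> ~ has_code B k].
  congr measurable; apply/seteqP; split=> B /=.
    by move=> [[? ?] ?]; apply/next_codeP.
  by move=> /next_codeP [].
apply: (sigma_and sa); first by apply: (sigma_and sa); [exact: (sigma_prop sa)|exact: mc].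
apply: (sigma_all sa) => k; apply: (sigma_guard sa) => _.
by apply: (sigma_not sa); exact: mc.
Qed.

(** * The translation quasi-order on infinite subsets *)

Lemma t_leP (G : groupType) (A B : set G) : t_le A B <->
  exists2 s : seq G, s != [::] &
    forall x, A x <-> forall g, g \in s -> B (g^-1 * x)%g.
Proof.
have mem_shift (g x : G) : [set (g * y)%g | y in B] x <-> B (g^-1 * x)%g.
  split=> [[y By <-]|Bx]; first by rewrite mulKg.
  by exists (g^-1 * x)%g => //; rewrite mulVKg.
split=> [[n [g [n0 ->]]]|[s s0 As]].
  exists [seq g i | i <- enum 'I_n].
    by rewrite -size_eq0 size_map size_enum_ord -lt0n.
  move=> x; split=> [H _ /mapP [i _ ->]|H i _]; first exact/mem_shift/H.
  by apply/mem_shift/H/map_f; rewrite mem_enum.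
exists (size s), (fun i => nth 1%g s i); split; first by rewrite lt0n size_eq0.
apply/seteqP; split=> [x /As H i _|x H]; first exact/mem_shift/H/mem_nth.
apply/As => g gs; apply/mem_shift.
have gi : index g s < size s by rewrite index_mem.
by have := H (Ordinal gi) I; rewrite /= nth_index.
Qed.

Lemma t_le_refl (G : groupType) (A : set G) : t_le A A.
Proof.
apply/t_leP; exists [:: 1%g] => // x; split=> [Ax g|].
  by rewrite inE => /eqP ->; rewrite invg1 mul1g.
by move=> /(_ 1%g); rewrite inE eqxx invg1 mul1g; apply.
Qed.

Lemma t_le_trans (G : groupType) (A B C : set G) :
  t_le A B -> t_le B C -> t_le A C.
Proof.
move=> /t_leP [s s0 As] /t_leP [t t0 Bt]; apply/t_leP.
exists [seq (g * h)%g | g <- s, h <- t].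
  by rewrite -size_eq0 size_allpairs muln_eq0 !size_eq0 negb_or s0.
move=> x; split=> [/As H _ /allpairsP [[g h] /= [gs ht ->]]|H].
  by rewrite invgM -mulgA; apply: (Bt _).1 ht; exact: H.
apply/As => g gs; apply/Bt => h ht; rewrite mulgA -invgM.
by apply: H; apply: allpairs_f.
Qed.

(** In the form [t_leP] the quasi-order quantifies only over elements and finite lists of a
    countable group, so it is Borel. A predecessor of B is determined by B and the list of
    translations. *)
Lemma countable_borel_t_le (R : realType) :
  countable_borel_quasiorder R t_le_OmegaFinf.
Proof.
split.
- exact: standard_borel_omega.
- by move=> A; exact: t_le_refl.
- by move=> A B C; exact: t_le_trans.
- have sa := @sigma_measurable _ (OmegaFinf * OmegaFinf)%type.
  have m1 x : measurable [set p : OmegaFinf * OmegaFinf | set_val p.1 x].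
    have := @measurable_fst _ _ OmegaFinf OmegaFinf measurableT _ (measurable_omega_mem x).
    by rewrite setTI.
  have m2 x : measurable [set p : OmegaFinf * OmegaFinf | set_val p.2 x].
    have := @measurable_snd _ _ OmegaFinf OmegaFinf measurableT _ (measurable_omega_mem x).
    by rewrite setTI.
  suff : measurable [set p : OmegaFinf * OmegaFinf | exists s : seq Finf, s != [::] /\
      forall x, set_val p.1 x <-> forall g, g \in s -> set_val p.2 (g^-1 * x)%g].
    congr measurable; apply/seteqP; split=> p /=.
      by move=> [s [s0 H]]; apply/t_leP; exists s.
    by move=> /t_leP [s s0 H]; exists s.
  apply: (sigma_ex sa) => s; apply: (sigma_and sa); first exact: (sigma_prop sa).
  apply: (sigma_all sa) => x; apply: (sigma_iff sa); first exact: m1.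
  apply: (sigma_all sa) => g; apply: (sigma_guard sa) => _.
  exact: m2.
- move=> B.
  have /(@choice _ _ _) [f Hf] : forall A : OmegaFinf, exists s : seq Finf,
      t_le_OmegaFinf A B ->
      forall x, set_val A x <-> forall g, g \in s -> set_val B (g^-1 * x)%g.
    move=> A; have [/t_leP [s _ H]|] := pselect (t_le_OmegaFinf A B).
      by exists s.
    by exists [::].
  apply/countable_injP; exists (pickle \o f) => A A' /set_mem tA /set_mem tA' /=.
  move=> /(pcan_inj pickleK) ff; apply: val_inj; apply/seteqP; split=> x.
    by move=> /(Hf A tA) H; apply/(Hf A' tA'); rewrite -ff.
  by move=> /(Hf A' tA') H; apply/(Hf A tA); rewrite ff.
Qed.

(** * Coding a Polish space in the Cantor space *)

Lemma sigma_preimage (T : Type) (L : Type) (phi : T -> nat -> L) :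
  sigma_algebra [set: T]
    [set A | exists2 B, borel_seq B & forall x, A x <-> B (phi x)].
Proof.
have sa := @sigma_borel_seq L.
split.
- by exists set0; first exact: (sigma_prop sa False).
- move=> A [B bB AB]; exists [set e | ~ B e]; first exact: (sigma_not sa).
  by move=> x; split=> [[_ + /AB]|nB] //; split=> // /AB.
- move=> A /(_ _) HA.
  have /(@choice _ _ _) [B HB] : forall n, exists B, borel_seq B /\
      forall x, A n x <-> B (phi x).
    by move=> n; have [B] := HA n; exists B.
  exists [set e | exists n, B n e].
    by apply: (sigma_ex sa) => n; have [] := HB n.
  move=> x; split=> [[n _]|[n]].
    by have [_ H] := HB n => /H; exists n.
  by have [_ H] := HB n => /H; exists n.
Qed.

Section MetricCode.
Variables (R : realType) (M : metricType R) (c : nat -> M) (r : nat -> R).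
Local Notation dist := (@mdist R M).
Local Open Scope ring_scope.

Hypothesis complete : forall F : set_system M, ProperFilter F -> cauchy F ->
  exists x : M, F --> x.
Hypothesis basis : forall (x : M) (e : R), 0 < e ->
  exists2 n, dist (c n) x < r n & r n < e.

Definition metric_code (x : M) (n : nat) : bool := dist (c n) x < r n.

Lemma metric_code_inj : injective metric_code.
Proof.
move=> x y xy; apply/eqP; apply: contrapT => /negP nxy.
have xy0 : 0 < dist x y / 2 by rewrite divr_gt0 // mdist_gt0.
have [n nx rn] := basis x xy0.
have := congr1 (@^~ n) xy; rewrite /= /metric_code nx => /esym ny.
by have := metric_triangle x (c n) y; rewrite [dist x (c n)]metric_sym; lra.
Qed.

Lemma metric_code_open n : open [set x | metric_code x n].
Proof.
rewrite openE => x /= xn; apply/nbhs_ballP.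
exists (r n - dist (c n) x); first by rewrite /= subr_gt0.
move=> y; rewrite ballEmdist /metric_code /= => xy.
by have := metric_triangle (c n) x y; lra.
Qed.

Lemma metric_borel_code (A : set M) : <<s @open M >> A ->
  exists2 B, borel_seq B & forall x, A x <-> B (metric_code x).
Proof.
move: A; apply: smallest_sigma_ind; first exact: sigma_preimage.
move=> A; rewrite openE => oA.
exists [set z : nat -> bool | exists n,
    (forall y, metric_code y n -> A y) /\ z n].
  have sa := @sigma_borel_seq bool.
  apply: (sigma_ex sa) => n; apply: (sigma_and sa); first exact: (sigma_prop sa).
  exact: (borel_coord n (fun b : bool => b)).
move=> x; split=> [Ax|[n [+ xn]]]; last exact.
have [e /= e0 xe] := (nbhs_ballP _ _).1 (oA x Ax).
have e20 : 0 < e / 2 by rewrite divr_gt0.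
have [n nx rn] := basis x e20; exists n; split=> // y ny.
apply: xe; rewrite ballEmdist /=; move: ny; rewrite /metric_code => ny.
by have := metric_triangle x (c n) y; rewrite [dist x (c n)]metric_sym; lra.
Qed.

(* A point is recovered from the basic balls declared to contain it as soon as
   these are arbitrarily small, pairwise close enough to meet, and every one of
   them contains the closure of another one, with room to spare. *)
Let coherent := [set z : nat -> bool |
  ((forall k, exists n, r n < 2^-1 ^+ k /\ z n) /\
   (forall n n', z n -> z n' -> dist (c n) (c n') < r n + r n')) /\
  forall n, z n <-> exists n', dist (c n) (c n') + r n' < r n /\ z n'].

Lemma metric_code_coherent x : coherent (metric_code x).
Proof.
split; first split.
- move=> k; have k0 : 0 < 2^-1 ^+ k :> R by rewrite exprn_gt0 // invr_gt0.
  by have [n] := basis x k0; exists n.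
- move=> n n'; rewrite /metric_code => nx n'x.
  by have := metric_triangle (c n) x (c n'); rewrite [dist x _]metric_sym; lra.
- rewrite /metric_code => n; split=> [nx|[n' [nn' n'x]]].
    have e0 : 0 < (r n - dist (c n) x) / 2 by rewrite divr_gt0 // subr_gt0.
    have [n' n'x rn'] := basis x e0; exists n'; split=> //.
    by have := metric_triangle (c n) x (c n'); rewrite [dist x _]metric_sym; lra.
  by have := metric_triangle (c n) (c n') x; lra.
Qed.

(** Centres of declared balls with radii below [2^-1 ^+ k] form a Cauchy sequence. Its limit lies in
    the closed version of each declared ball, hence by the last clause in the ball itself.
    Conversely, a ball containing the limit contains a small declared ball with room to spare, so it
    is declared. *)
Lemma coherent_metric_code z : coherent z -> exists x, metric_code x = z.
Proof.
move=> [[/(@choice _ _ _) [n Hn] meet] shrink].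
have small e : 0 < e -> exists K, forall k, (K <= k)%N -> r (n k) < e.
  move=> e0; have [K HK] := half_pow_lt e0; exists K => k Kk.
  apply: lt_trans (lt_le_trans (Hn k).1 _) HK.
  by rewrite ler_wiXn2l ?invr_ge0 // invf_le1 ?ltr0n // ler1n.
pose F := (fun k => c (n k)) @ \oo.
have [x Fx] : exists x : M, F --> x.
  apply: complete; apply/cauchy_ballP => e e0.
  have e20 : 0 < e / 2 by rewrite divr_gt0.
  have [K HK] := small _ e20.
  pose A := [set x | exists2 k, (K <= k)%N & x = c (n k)].
  have FA : F A by exists K => // k /= Kk; exists k.
  exists (A, A) => // -[_ _] /= [[k Kk ->] [l Kl ->]].
  rewrite ballEmdist /=; have := meet _ _ (Hn k).2 (Hn l).2.
  by have := HK _ Kk; have := HK _ Kl; lra.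
have near_x e : 0 < e -> exists k, r (n k) < e /\ dist (c (n k)) x < e.
  move=> e0; have [K HK] := small _ e0.
  have [K' _ HK'] := Fx _ (nbhsx_ballx x e e0).
  exists (maxn K K'); split; first by apply: HK; rewrite leq_maxl.
  have := HK' (maxn K K') (leq_maxr _ _).
  by rewrite /= ballEmdist /= metric_sym.
have zle m : z m -> dist (c m) x <= r m.
  move=> zm; rewrite leNgt; apply/negP => lt_rm.
  have e0 : 0 < (dist (c m) x - r m) / 2 by rewrite divr_gt0 // subr_gt0.
  have [k [rk kx]] := near_x _ e0.
  have := meet _ _ zm (Hn k).2; have := metric_triangle (c m) (c (n k)) x.
  by lra.
exists x; apply/funext => m; apply/idP/idP; rewrite /metric_code.
  move=> mx; apply/shrink.
  have e0 : 0 < (r m - dist (c m) x) / 2 by rewrite divr_gt0 // subr_gt0.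
  have [k [rk kx]] := near_x _ e0; exists (n k); split; last exact: (Hn k).2.
  have := metric_triangle (c m) x (c (n k)); rewrite [dist x _]metric_sym.
  by lra.
move=> /shrink [m' [mm' /zle zm']].
by have := metric_triangle (c m) (c m') x; lra.
Qed.

(** The inequalities between centres and radii do not involve z, so [coherent] is a countable
    combination of conditions on single bits. *)
Lemma borel_range_metric_code : borel_seq (range metric_code).
Proof.
suff : borel_seq coherent.
  congr borel_seq; apply/seteqP; split=> z.
    by move=> /coherent_metric_code [x <-]; exists x.
  by move=> [x _ <-]; exact: metric_code_coherent.
have sa := @sigma_borel_seq bool.
have bz n : borel_seq [set z : nat -> bool | z n].
  exact: (borel_coord n (fun b : bool => b)).
apply: (sigma_and sa); first apply: (sigma_and sa).
- apply: (sigma_all sa) => k; apply: (sigma_ex sa) => n.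
  by apply: (sigma_and sa); [exact: (sigma_prop sa)|exact: bz].
- apply: (sigma_all sa) => n; apply: (sigma_all sa) => n'.
  apply: (sigma_imp sa); first exact: bz.
  by apply: (sigma_imp sa); [exact: bz|exact: (sigma_prop sa)].
- apply: (sigma_all sa) => n; apply: (sigma_iff sa); first exact: bz.
  apply: (sigma_ex sa) => n'.
  by apply: (sigma_and sa); [exact: (sigma_prop sa)|exact: bz].
Qed.

End MetricCode.

Lemma polish_basis (R : realType) (M : metricType R) (x0 : M) : polish M ->
  exists (c : nat -> M) (r : nat -> R), forall (x : M) (e : R), (0 < e)%R ->
    exists2 n, (mdist (c n) x < r n)%R & (r n < e)%R.
Proof.
move=> [[D cD dD] _]; have [y Hy] := countable_enum x0 cD.
pose q n : nat * nat := odflt (0, 0) (unpickle n).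
exists (fun n => y (q n).1), (fun n => 2^-1 ^+ (q n).2)%R => x e e0.
have [k ke] := half_pow_lt e0.
have k0 : (0 < 2^-1 ^+ k :> R)%R by rewrite exprn_gt0 // invr_gt0.
have [||z [zx /Hy [j zj]]] := dD (interior (ball x (2^-1 ^+ k)%R)).
- by exists x; exact: nbhsx_ballx.
- exact: open_interior.
exists (pickle (j, k)); rewrite /q pickleK //= -zj.
by have := interior_subset zx; rewrite ballEmdist /= metric_sym.
Qed.

Lemma standard_borel_code (R : realType) (d : measure_display)
    (X : measurableType d) : standard_borel R X ->
  exists i : X -> nat -> bool, [/\ injective i, borel_seq (range i),
    forall n, measurable [set x | i x n] &
    forall A : set X, measurable A ->
      exists2 B, borel_seq B & forall x, A x <-> B (i x)].
Proof.
move=> [M [f [pM [g fK gK] mf]]].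
have [c [r basis]] := polish_basis (f point) pM.
have [_ complete] := pM.
exists (metric_code c r \o f); split.
- exact: inj_comp (metric_code_inj basis) (can_inj fK).
- have := borel_range_metric_code complete basis; congr borel_seq.
  apply/seteqP; split=> z [x _ <-]; last by exists (f x).
  by exists (g x) => //=; rewrite gK.
- move=> n; apply/mf; apply: sub_sigma_algebra.
  rewrite (_ : _ @` _ = [set x | metric_code c r x n]).
    exact: metric_code_open.
  apply/seteqP; split=> [_ [x nx <-] //|x nx].
  by exists (g x); rewrite /= gK.
- move=> A /mf /(metric_borel_code basis) [B bB AB]; exists B => // x.
  rewrite -[B _]/(B (metric_code c r (f x))); split=> [Ax|/AB [y Ay]].
    by apply/AB; exists x.
  by move/(can_inj fK) => <-.
Qed.

(** Zipping two codes into a sequence of pairs turns the projections, which generate the product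
    sigma-algebra, into letterwise maps. *)
Lemma measurable_pair_code (d : measure_display) (X : measurableType d)
    (i : X -> nat -> bool) :
  (forall A : set X, measurable A ->
      exists2 B, borel_seq B & forall x, A x <-> B (i x)) ->
  forall Q : set (X * X), measurable Q ->
  exists2 B, borel_seq B &
    forall x y, Q (x, y) <-> B (fun k => (i x k, i y k)).
Proof.
move=> mi Q mQ.
suff [B bB QB] : exists2 B, borel_seq B &
    forall p, Q p <-> B (fun k => (i p.1 k, i p.2 k)).
  by exists B => // x y; exact: (QB (x, y)).
move: Q mQ; apply: smallest_sigma_ind; first exact: sigma_preimage.
move=> _ [[A /mi [B bB AB] <-]|[A /mi [B bB AB] <-]].
  exists [set e : nat -> bool * bool | B (fun k => (e k).1)].
    exact: borel_preimage (borel_letter _) bB.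
  by move=> p; rewrite setTI; exact: AB.
exists [set e : nat -> bool * bool | B (fun k => (e k).2)].
  exact: borel_preimage (borel_letter _) bB.
by move=> p; rewrite setTI; exact: AB.
Qed.

(** * The reduction *)

Section Coding.
Local Notation C := (nat -> bool).
Variable f : nat -> C -> C.

(* The generators 4n and 4n+1 play the role of the letters a_n and b_n, whose
   inverses apply f_n; the generators 4n+2 and 4n+3 record that the n-th bit is
   0 and 1 respectively. *)
Fixpoint code_word (v : C) (w : seq (nat * bool)) {struct w} : bool :=
  if w is (m, s) :: w' then
    if m %% 4 < 2 then s && code_word (f (m %/ 4) v) w'
    else [&& ~~ s, w' == [::] & v (m %/ 4) == (m %% 4 == 3)]
  else true.

Definition code_set (v : C) : set Finf := [set x | code_word v (val x)].

Definition bit_gen (v : C) (k : nat) : nat := 4 * k + 2 + v k.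

Lemma bit_genE v k : (bit_gen v k %/ 4 = k) * ((bit_gen v k %% 4 == 3) = v k) *
  ((bit_gen v k %% 4 < 2) = false).
Proof.
by rewrite /bit_gen -addnA [4 * k]mulnC divnMDl // modnMDl; case: (v k); rewrite addn0.
Qed.

Lemma code_word_bit u v k :
  code_word v [:: (bit_gen u k, false)] = (v k == u k).
Proof. by rewrite /= !bit_genE. Qed.

Lemma code_set_bit v k : code_set v (fg_gen (bit_gen v k)).
Proof. by have := code_word_bit v v k; rewrite eqxx. Qed.

Lemma code_set_infinite v : infinite_set (code_set v).
Proof.
move=> fin; apply: infinite_nat.
have -> : [set: nat] = (fun k => fg_gen (bit_gen v k)) @^-1` code_set v.
  by apply/seteqP; split=> // k _; exact: code_set_bit.
apply: finite_preimage fin => k l _ _ /fg_gen_inj kl.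
by rewrite -(bit_genE v k) kl bit_genE.
Qed.

Lemma push_gen m (x : Finf) :
  val ((fg_gen m)^-1 * x)%g = push (m, true) (val x).
Proof. by []. Qed.

(* If x starts with a_n or b_n then both sides are false: code_word rejects the
   positive letters a_n and b_n, and only one of the two products cancels. *)
Lemma code_set_image n v (x : Finf) : code_set (f n v) x <->
  code_set v ((fg_gen (4 * n)%N)^-1 * x)%g /\
  code_set v ((fg_gen (4 * n + 1)%N)^-1 * x)%g.
Proof.
rewrite /code_set /mkset !push_gen.
have E0 : ((4 * n) %/ 4 = n) * ((4 * n) %% 4 < 2 = true) by split; lia.
have E1 : ((4 * n + 1) %/ 4 = n) * ((4 * n + 1) %% 4 < 2 = true) by split; lia.
case: (val x) => [|[m s] w]; rewrite /push /linv ?[(_, _).1]/= ?[(_, _).2]/=.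
  by rewrite /= !E0 !E1.
rewrite !xpair_eqE.
have [->|m0] := eqVneq m (4 * n).
  have -> : (4 * n == 4 * n + 1) = false by lia.
  by case: s; rewrite /= !(E0, E1) /=; [split=> [|[]]|split=> // -[]].
have [->|m1] := eqVneq m (4 * n + 1).
  by case: s; rewrite /= !(E0, E1) /=; [split=> [|[]]|split=> // -[]].
by rewrite /= !(E0, E1); split=> [|[]].
Qed.

Lemma t_le_code_set n v : t_le (code_set (f n v)) (code_set v).
Proof.
apply/t_leP; exists [:: fg_gen (4 * n); fg_gen (4 * n + 1)] => // x.
apply: (iff_trans (code_set_image n v x)); split.
  by move=> [? ?] g; rewrite !inE => /orP[] /eqP ->.
by move=> H; split; apply: H; rewrite !inE eqxx ?orbT.
Qed.

(** A code word without bit letters only moves [v] along maps [f n]; a bit letter must be last, so a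
    word containing one has no proper extension in the code. *)
Lemma code_word_cat v w : code_word v w ->
  (exists p, forall t, code_word v (w ++ t) =
     code_word (foldl (fun v n => f n v) v p) t) \/
  forall l t, code_word v (w ++ l :: t) = false.
Proof.
elim: w v => [|[m s] w IH] v /=; first by move=> _; left; exists [::].
case: ifP => _; last first.
  by case/and3P => _ /eqP -> _; right=> l t; rewrite andbF.
case/andP => -> /IH [[p Hp]|H]; [left|by right].
by exists (m %/ 4 :: p) => t /=; exact: Hp.
Qed.

(** A cancellation would require [w] to end in the inverse of a bit letter, but code words contain
    bit letters only with positive sign. *)
Lemma wmul_letter v w m : ~~ (m %% 4 < 2) -> reduced w -> code_word v w ->
  wmul w [:: (m, false)] = w ++ [:: (m, false)].
Proof.
move=> m2; elim: w v => [//|[m' s] w IH] v rw /= cw.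
have rw' : reduced w by exact: path_sorted rw.
have -> : wmul w [:: (m, false)] = w ++ [:: (m, false)].
  case: ifP cw => _; first by move=> /andP[_]; exact: IH.
  by move=> /and3P[_ /eqP -> _].
case: w rw {rw' IH} cw => [_ cw|b w].
  rewrite /= xpair_eqE; have [mm|//] := eqVneq m m'.
  by move: cw; rewrite -mm (negbTE m2); case: s.
by rewrite /reduced /= => /andP[/negbTE ->].
Qed.

(** A single translate suffices. The empty word puts g^-1 into [code_set v]; since every bit letter
    of [u] can be appended to it, g^-1 consists of moves and leads to a point with the bits of
    [u]. *)
Lemma t_le_code_setP u v : t_le (code_set u) (code_set v) ->
  exists p, u = foldl (fun v n => f n v) v p.
Proof.
move=> /t_leP [[//|g s] _ Hs].
have mem x : code_set u x -> code_set v (g^-1 * x)%g.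
  by move=> /Hs; apply; rewrite inE eqxx.
have cg : code_word v (val (g^-1)%g).
  by have := mem 1%g isT; rewrite mulg1.
have bit k : code_word v (val (g^-1)%g ++ [:: (bit_gen u k, false)]).
  rewrite -(@wmul_letter v) ?bit_genE //; last exact: (valP (g^-1)%g).
  exact: (mem (fg_gen (bit_gen u k)) (code_set_bit u k)).
have [[p Hp]|H] := code_word_cat cg; last by have := bit 0; rewrite H.
exists p; apply/funext => k; have := bit k.
by rewrite Hp code_word_bit => /eqP.
Qed.

Hypothesis bf : forall n, borel_map (f n).

Lemma borel_code_word w : borel_seq [set v | code_word v w].
Proof.
have sa := @sigma_borel_seq bool.
elim: w => [|[m s] w IH]; first exact: (sigma_prop sa true).
rewrite /=; case: (m %% 4 < 2).
  have := sigma_and sa (sigma_prop sa s) (borel_preimage (bf (m %/ 4)) IH).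
  by congr borel_seq; apply/seteqP; split=> v /= /andP.
exact: (borel_coord (m %/ 4) (fun b => [&& ~~ s, w == [::] & b == (m %% 4 == 3)])).
Qed.

End Coding.

Lemma measurable_borel_code (d : measure_display) (X : measurableType d)
    (i : X -> nat -> bool) : (forall n, measurable [set x | i x n]) ->
  forall B, borel_seq B -> measurable [set x | B (i x)].
Proof.
move=> mi; have sa := @sigma_measurable _ X.
apply: (smallest_sigma_ind (sigma_pushforward i sa)).
move=> _ [k [[] ->]]; first exact: mi.
have := sigma_not sa (mi k); congr measurable.
by apply/seteqP; split=> x /= => [/negP/negbTE|->].
Qed.

Lemma measurable_fun_omega (d : measure_display) (X : measurableType d)
    (F : X -> OmegaFinf) :
  (forall y, measurable [set x | set_val (F x) y]) -> measurable_fun setT F.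
Proof.
move=> mF _ Y mY; rewrite setTI; move: Y mY.
have sa := @sigma_measurable _ X.
exact: (measurable_omega_ind (sigma_pushforward F sa)).
Qed.

Lemma universal_t_le (R : realType) (d : measure_display)
    (X : measurableType d) (Q : X -> X -> Prop) :
  countable_borel_quasiorder R Q -> borel_reducible Q t_le_OmegaFinf.
Proof.
move=> [sbX Qxx Qtrans mQ cQ].
have [i [i_inj bi mi imeas]] := standard_borel_code sbX.
have [B bB QB] := measurable_pair_code imeas mQ.
have sa2 := @sigma_borel_seq (bool * bool)%type.
have sa := @sigma_borel_seq bool.
(* [B] describes [Q] only on codes, so both coordinates are required to lie in the range of [i]. *)
pose P := [set e : nat -> bool * bool | (range i (fun k => (e k).1) /\
   range i (fun k => (e k).2)) /\ B e].
have bP : borel_seq P.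
  apply: (sigma_and sa2) => //; apply: (sigma_and sa2).
    exact: borel_preimage (borel_letter _) bi.
  exact: borel_preimage (borel_letter _) bi.
have PQ x y : P (fun k => (i x k, i y k)) <-> Q x y.
  split=> [[_ Be]|/(QB x y) Be]; first exact/(QB x y).
  by split; first by split; [exists x|exists y].
have cP v : countable [set u | P (fun k => (u k, v k))].
  have [[y _ <-]|nv] := pselect (range i v); last first.
    rewrite (_ : [set _ | _] = set0) //; apply/seteqP; split=> // u.
    by move=> [[_ /nv]].
  apply: (@sub_countable _ _ _ [set x | Q x y]) => //.
  apply: card_le_trans (card_image_le i _); apply: subset_card_le => u Pu.
  by have [[[x _ /= xu] _] _] := Pu; exists x => //; apply/PQ; rewrite xu.
have [G [bG HG]] := lusin_novikov bP cP.
(* Where [G n v] is not the code of a predecessor, v itself is used; by reflexivity, every move from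
   the code of y then leads to the code of a predecessor of y. *)
pose f n v := if `[< P (fun k => (G n v k, v k)) >] then G n v else v.
have bf n : borel_map (f n).
  have bGv : borel_map (fun v k => (G n v k, v k)).
    move=> k [l l']; have := sigma_and sa (bG n k l) (borel_coord k (fun b => b = l')).
    by congr borel_seq; apply/seteqP; split=> v /=; [case=> -> ->|case].
  have bPG := borel_preimage bGv bP.
  move=> k l; have := sigma_or sa (sigma_and sa bPG (bG n k l))
    (sigma_and sa (sigma_not sa bPG) (borel_coord k (fun b => b = l))).
  congr borel_seq; apply/seteqP; split=> v /=; rewrite /f; case: asboolP => Pv.
  - by case=> -[].
  - by case=> -[].
  - by left.
  - by right.
have f_below y n : exists2 y', f n (i y) = i y' & Q y' y.
  rewrite /f; case: asboolP => [Py|_]; last by exists y.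
  by have [[[x _ xG] _] _] := Py; exists x; [|apply/PQ; rewrite xG].
have fold_below p y : exists2 y', foldl (fun v n => f n v) (i y) p = i y' & Q y' y.
  elim: p y => [|n p IH] y /=; first by exists y.
  have [y1 -> Qy1] := f_below y n; have [y2 -> Qy2] := IH y1.
  by exists y2 => //; exact: Qtrans Qy2 Qy1.
pose F x : OmegaFinf := exist (fun A => A \in @infinite_subsets Finf)
  (code_set f (i x)) (mem_set (code_set_infinite (f := f) (v := i x))).
exists F.
  apply: measurable_fun_omega => y.
  exact: (measurable_borel_code mi (borel_code_word bf (val y))).
move=> x y; split=> [Qxy|/t_le_code_setP [p]].
  have [n xn] := HG _ _ ((PQ x y).2 Qxy).
  have : t_le (code_set f (f n (i y))) (code_set f (i y)) by exact: t_le_code_set.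
  by rewrite /f; case: asboolP; rewrite -xn // => -[]; apply/PQ.
by have [y' -> Qy'] := fold_below p y => /i_inj ->.
Qed.

Theorem theorem4p2 (R : realType) :
  universal_countable_borel_quasiorder R t_le_OmegaFinf.
Proof.
split; first exact: countable_borel_t_le.
by move=> d X Q; exact: universal_t_le.
Qed.
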